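(* Let $P\in\mathbb C[x_1,x_2,x_3]$ be any polynomial from the following list (with the indicated parameters): (PV) $x_1x_2x_3+x_1^2+x_2^2-(s_1+s_2s_3)x_1-(s_2+s_1s_3)x_2-s_3x_3+(s_3^2+s_1s_2s_3+1)$, $s_1,s_2\in\mathbb C$, $s_3\in\mathbb C^*$; (PV$^{\deg}$) $x_1x_2x_3+x_1^2+x_2^2+s_1x_1+s_2x_2+1$, $s_1,s_2\in\mathbb C$; (PIII(D6)) $x_1x_2x_3+x_1^2+x_2^2+(1+\alpha\beta)x_1+(\alpha+\beta)x_2+\alpha\beta$, $\alpha,\beta\in\mathbb C^*$; (PIII(D7)) $x_1x_2x_3+x_1^2+x_2^2+\alpha x_1+x_2$, $\alpha\in\mathbb C^*$; (PIII(D8)) $x_1x_2x_3+x_1^2-x_2^2-x_1$; (PIV) $x_1x_2x_3+x_1^2-(s_2^2+s_1s_2)x_1-s_2^2x_2-s_2^2x_3+(s_2^2+s_1s_2^3)$, $s_1\in\mathbb C$, $s_2\in\mathbb C^*$; (PII$^{FN}$) $x_1x_2x_3+x_1-x_2+x_3+s$, $s\in\mathbb C$; (PII) $x_1x_2x_3-x_1-\alpha x_2-x_3+\alpha+1$, $\alpha\in\mathbb C^*$; (PI) $x_1x_2x_3+x_1+x_2+1$. Let $S=\{P=0\}\subset\mathbb C^3$, with symplectic form $\Omega=\frac{dx_1\wedge dx_2}{P_{x_3}}=\frac{dx_2\wedge dx_3}{P_{x_1}}=\frac{dx_3\wedge dx_1}{P_{x_2}}$ (where $P_{x_i}=\partial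 P/\partial x_i$), and foliations $\mathcal F_i=\ker(dx_i|_S)$, $i=1,2,3$. Then: (1) the $3$-web $(\mathcal F_1,\mathcal F_2,\mathcal F_3)$ is not (locally) parallelizable, except in the cases PII$^{FN}$, PII, PI; (2) for at least one pair $\{i,j\}\subset\{1,2,3\}$, the Hess connection of the bi-Lagrangian manifold $(S,\Omega,\mathcal F_i,\mathcal F_j)$ is not flat.
   Context: A regular $3$-web is a triple of pairwise transversal holomorphic foliations on a complex surface; it is locally parallelizable if in suitable local holomorphic coordinates each foliation is given by a constant $1$-form (parallel lines). Everything is considered on the open subset of smooth points of $S$ where the relevant foliations are pairwise transversal. The Hess connection of a bi-Lagrangian surface $(M,\omega,\mathcal F,\mathcal G)$ (transversal foliations by curves) is the unique torsion-free affine connection $\nabla$ with $X\cdot\omega(Y,Z)=\omega(\nabla_XY,Z)+\omega(Y,\nabla_XZ)$ and preserving both foliations (i.e. $\nabla_XY$ tangent to a foliation whenever $Y$ is); it is flat if its curvature tensor vanishes identically. *)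

(* Defs.v *)
(* The complex numbers are  R[i]  for an
   arbitrary  R : realType  (mathcomp-real-closed's complex), viewed as a normed
   module over itself ( R[i]^o ); "holomorphic" = Frechet-differentiable over the
   field R[i] (i.e. with an R[i]-linear differential). *)
From HB Require Import structures.
From mathcomp Require Import all_boot all_order all_algebra.
From mathcomp Require Import complex.
From mathcomp Require Import all_classical all_reals all_analysis.
Set Implicit Arguments. Unset Strict Implicit. Unset Printing Implicit Defensive.
Import Order.TTheory GRing.Theory Num.Theory.
Import numFieldNormedType.Exports.
Local Open Scope ring_scope.
Local Open Scope classical_set_scope.

Notation C2 R := ((R[i])^o * (R[i])^o)%type.
Notation C3 R := ((R[i])^o * (R[i])^o * (R[i])^o)%type.

Definition coord3 (R : realType) (k : 'I_3) (p : C3 R) : R[i] :=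
  if val k == 0%N then p.1.1 else if val k == 1%N then p.1.2 else p.2.
Definition e3 (R : realType) (k : 'I_3) : C3 R :=
  (((val k == 0%N)%:R, (val k == 1%N)%:R), (val k == 2%N)%:R).
Definition coord2 (R : realType) (k : 'I_2) (w : C2 R) : R[i] :=
  if val k == 0%N then w.1 else w.2.
Definition e2 (R : realType) (k : 'I_2) : C2 R :=
  ((val k == 0%N)%:R, (val k == 1%N)%:R).
Definition mk2 (R : realType) (F : 'I_2 -> R[i]) : C2 R := (F ord0, F ord_max).

Inductive painleve_family (R : realType) :=
| PV     of R[i] & R[i] & R[i]
| PVdeg  of R[i] & R[i]
| PIIID6 of R[i] & R[i]
| PIIID7 of R[i]
| PIIID8
| PIV    of R[i] & R[i]
| PIIFN  of R[i]
| PII    of R[i]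
| PI.

Definition admissible (R : realType) (f : painleve_family R) : Prop :=
  match f with
  | PV _ _ s3 => s3 != 0
  | PVdeg _ _ => True
  | PIIID6 a b => a != 0 /\ b != 0
  | PIIID7 a => a != 0
  | PIIID8 => True
  | PIV _ s2 => s2 != 0
  | PIIFN _ => True
  | PII a => a != 0
  | PI => True
  end.

Definition exceptional (R : realType) (f : painleve_family R) : bool :=
  match f with PIIFN _ | PII _ | PI => true | _ => false end.

Definition painleve_poly (R : realType) (f : painleve_family R) (p : C3 R) : R[i] :=
  let x1 := coord3 ord0 p in
  let x2 := coord3 (inord 1) p in
  let x3 := coord3 ord_max p in
  match f with
  | PV s1 s2 s3 => x1*x2*x3 + x1^+2 + x2^+2 - (s1 + s2*s3)*x1 - (s2 + s1*s3)*x2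
                   - s3*x3 + (s3^+2 + s1*s2*s3 + 1)
  | PVdeg s1 s2 => x1*x2*x3 + x1^+2 + x2^+2 + s1*x1 + s2*x2 + 1
  | PIIID6 a b => x1*x2*x3 + x1^+2 + x2^+2 + (1 + a*b)*x1 + (a + b)*x2 + a*b
  | PIIID7 a => x1*x2*x3 + x1^+2 + x2^+2 + a*x1 + x2
  | PIIID8 => x1*x2*x3 + x1^+2 - x2^+2 - x1
  | PIV s1 s2 => x1*x2*x3 + x1^+2 - (s2^+2 + s1*s2)*x1 - s2^+2*x2 - s2^+2*x3
                 + (s2^+2 + s1*s2^+3)
  | PIIFN s => x1*x2*x3 + x1 - x2 + x3 + s
  | PII a => x1*x2*x3 - x1 - a*x2 - x3 + a + 1
  | PI => x1*x2*x3 + x1 + x2 + 1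
  end.

Definition Pd (R : realType) (P : C3 R -> (R[i])^o) (k : 'I_3) (p : C3 R) : R[i] :=
  derive P p (e3 R k).

Definition smooth_pt (R : realType) (P : C3 R -> (R[i])^o) (p : C3 R) : Prop :=
  P p = 0 /\ exists k, Pd P k p != 0.

Definition tangentS (R : realType) (P : C3 R -> (R[i])^o) (p v : C3 R) : Prop :=
  \sum_(k < 3) Pd P k p * coord3 k v = 0.

Definition transversal (R : realType) (P : C3 R -> (R[i])^o) (i j : 'I_3) (p : C3 R) : Prop :=
  forall v, tangentS P p v -> coord3 i v = 0 -> coord3 j v = 0 -> v = 0.

Definition S_web (R : realType) (P : C3 R -> (R[i])^o) : set (C3 R) :=
  [set p | smooth_pt P p /\ forall i j : 'I_3, i != j -> transversal P i j p].
Definition S_pair (R : realType) (P : C3 R -> (R[i])^o) (i j : 'I_3) : set (C3 R) :=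
  [set p | smooth_pt P p /\ transversal P i j p].

(* the symplectic form Omega = dx1^dx2/P_x3 = dx2^dx3/P_x1 = dx3^dx1/P_x2 on T_p S *)
Definition Omega (R : realType) (P : C3 R -> (R[i])^o) (p X Y : C3 R) : R[i] :=
  let X1 := coord3 ord0 X in let X2 := coord3 (inord 1) X in let X3 := coord3 ord_max X in
  let Y1 := coord3 ord0 Y in let Y2 := coord3 (inord 1) Y in let Y3 := coord3 ord_max Y in
  if Pd P ord_max p != 0 then (X1 * Y2 - X2 * Y1) / Pd P ord_max p
  else if Pd P ord0 p != 0 then (X2 * Y3 - X3 * Y2) / Pd P ord0 p
  else (X3 * Y1 - X1 * Y3) / Pd P (inord 1) p.

(* a local holomorphic chart of the open piece U of S:
   psi : W -> U is a holomorphic injective immersion of an open W of C^2 whose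
   image is open in U (psi is the inverse of the coordinate map). *)
Definition is_chart (R : realType) (U : set (C3 R)) (W : set (C2 R))
    (psi : C2 R -> C3 R) : Prop :=
  [/\ open W,
      (forall w, W w -> differentiable psi w),
      {in W &, injective psi},
      (forall w, W w -> forall h : C2 R, 'd psi w h = 0 -> h = 0) &
      exists V : set (C3 R), open V /\ psi @` W = V `&` U].

(* in the chart, each foliation F_k = ker d(x_k o psi) equals ker(a du + b dv)
   for a constant nonzero 1-form a du + b dv *)
Definition parallelizing_chart (R : realType) (W : set (C2 R)) (psi : C2 R -> C3 R) : Prop :=
  forall k : 'I_3, exists a b : R[i], (a != 0 \/ b != 0) /\
    forall w, W w ->
      b * derive (fun z : C2 R => (coord3 k (psi z) : (R[i])^o)) w (e2 R ord0)
      = a * derive (fun z : C2 R => (coord3 k (psi z) : (R[i])^o)) w (e2 R ord_max).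

Definition web_parallelizable_at (R : realType) (P : C3 R -> (R[i])^o) (p : C3 R) : Prop :=
  exists (W : set (C2 R)) (psi : C2 R -> C3 R) (w0 : C2 R),
    [/\ is_chart (S_web P) W psi, W w0, psi w0 = p & parallelizing_chart W psi].

(* Christoffel symbols: nabla_{d_a} d_b = sum_k Gam k a b d_k *)
Definition Christoffel (R : realType) := 'I_2 -> 'I_2 -> 'I_2 -> C2 R -> (R[i])^o.

Definition holo_field (R : realType) (W : set (C2 R)) (X : C2 R -> C2 R) : Prop :=
  forall w, W w -> differentiable X w.

Definition vderiv (R : realType) (X : C2 R -> C2 R) (g : C2 R -> (R[i])^o) (w : C2 R) : R[i] :=
  \sum_(c < 2) coord2 c (X w) * derive g w (e2 R c).

Definition nabla (R : realType) (G : Christoffel R) (X Y : C2 R -> C2 R) (w : C2 R) : C2 R :=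
  mk2 (fun k : 'I_2 =>
    \sum_(c < 2) coord2 c (X w) *
       (derive (fun z : C2 R => (coord2 k (Y z) : (R[i])^o)) w (e2 R c)
        + \sum_(a < 2) coord2 a (Y w) * G k c a w)).

Definition lie (R : realType) (X Y : C2 R -> C2 R) (w : C2 R) : C2 R :=
  mk2 (fun k : 'I_2 =>
    vderiv X (fun z : C2 R => (coord2 k (Y z) : (R[i])^o)) w
    - vderiv Y (fun z : C2 R => (coord2 k (X z) : (R[i])^o)) w).

Definition curvature (R : realType) (G : Christoffel R) (X Y Z : C2 R -> C2 R) (w : C2 R) : C2 R :=
  nabla G X (nabla G Y Z) w - nabla G Y (nabla G X Z) w - nabla G (lie X Y) Z w.

Definition push (R : realType) (psi : C2 R -> C3 R) (Y : C2 R -> C2 R) (w : C2 R) : C3 R :=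
  'd psi w (Y w).

Definition is_hess (R : realType) (P : C3 R -> (R[i])^o) (i j : 'I_3)
    (W : set (C2 R)) (psi : C2 R -> C3 R) (G : Christoffel R) : Prop :=
  [/\ (forall k a b w, W w -> differentiable (G k a b) w),
      (forall X Y, holo_field W X -> holo_field W Y -> forall w, W w ->
          nabla G X Y w - nabla G Y X w - lie X Y w = 0),
      (forall X Y Z, holo_field W X -> holo_field W Y -> holo_field W Z ->
        forall w, W w ->
          vderiv X (fun z => (Omega P (psi z) (push psi Y z) (push psi Z z) : (R[i])^o)) w
          = Omega P (psi w) (push psi (nabla G X Y) w) (push psi Z w)
            + Omega P (psi w) (push psi Y w) (push psi (nabla G X Z) w)) &
      (forall l, l \in [:: i; j] ->
        forall X Y, holo_field W X -> holo_field W Y ->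
          (forall w, W w -> coord3 l (push psi Y w) = 0) ->
          forall w, W w -> coord3 l (push psi (nabla G X Y) w) = 0)].

Definition flat_on (R : realType) (W : set (C2 R)) (G : Christoffel R) : Prop :=
  forall X Y Z, holo_field W X -> holo_field W Y -> holo_field W Z ->
    forall w, W w -> curvature G X Y Z w = 0.

Definition hess_flat (R : realType) (P : C3 R -> (R[i])^o) (i j : 'I_3) : Prop :=
  forall (W : set (C2 R)) (psi : C2 R -> C3 R) (G : Christoffel R),
    is_chart (S_pair P i j) W psi -> is_hess P i j W psi G -> flat_on W G.

(* Main.v *)
(** All nine polynomials have the form
      P = x y z + A x^2 + B y^2 + p x + q y + c z + m,
    so where D := P_z = x y + c is nonzero, S is the graph z = f(x, y) of a
    rational function, and P_x D =: N1, P_y D =: N2 are polynomials in (x, y).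

    If the web is parallelizable near a point then, in the two parallelizing
    directions along which y (resp. x) is constant, x = a(s), y = b(t) and
    N1/N2 = const b'(t)/a'(s).  Hence
      N1(x,y) N1(x',y') N2(x,y') N2(x',y) = N1(x,y') N1(x',y) N2(x,y) N2(x',y')
    on an infinite grid, so identically; only first derivatives of the chart are
    used.  In the nonexceptional families this polynomial identity fails.

    In the exceptional families A = B = 0, and N1 and N2 are, up to sign, quadratic
    polynomials in y alone and in x alone.  The flows of x' = p x^2 + m x - q c and
    y' = q y^2 + m y - p c, which are Moebius transforms of exponentials (or of
    affine functions), give a parallelizing chart.

    Flatness fails for the pair (F_1, F_3) in every family: in the coordinates
    (x, z) the symplectic form is, up to sign, dx /\ dz / P_y, where P_y^2 = Delta is
    the discriminant of P in y, so the curvature is d^2 log Delta / dx dz up to a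
    nonzero factor, and this does not vanish identically. *)
Require Import Defs.
From HB Require Import structures.
From mathcomp Require Import all_boot all_order all_algebra.
From mathcomp Require Import complex ring lra.
From mathcomp Require Import all_classical all_reals all_analysis.
Set Implicit Arguments. Unset Strict Implicit. Unset Printing Implicit Defensive.
Import Order.TTheory GRing.Theory Num.Theory.
Import numFieldNormedType.Exports.
Local Open Scope ring_scope.
Local Open Scope classical_set_scope.

(** * Calculus with explicit differentials *)

(* [L] is only required to agree with the differential pointwise, so that it can be
   written as an explicit formula in the increment. *)
Definition hasd (K : numFieldType) (V : normedModType K) (f : V -> K) (w : V)
    (L : V -> K) : Prop :=
  differentiable (f : V -> K^o) w /\ forall h, 'd (f : V -> K^o) w h = L h.

Section HasD.
Context {K : numFieldType} {V : normedModType K}.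
Implicit Types (f g L : V -> K) (w h : V).

Lemma hasd_eq f w L L' : hasd f w L -> (forall h, L h = L' h) -> hasd f w L'.
Proof. by move=> [df dE] LE; split=> // h; rewrite dE. Qed.

Lemma hasd_derive f w L h : hasd f w L -> derive (f : V -> K^o) w h = L h.
Proof. by move=> [df <-]; rewrite deriveE. Qed.

Lemma hasd_cst w (c : K) : hasd (fun=> c) w (fun=> 0).
Proof.
split; first exact: (@differentiable_cst _ V K^o c).
by move=> h; rewrite (@diff_cst _ V K^o c).
Qed.

Lemma hasdD f g w L M : hasd f w L -> hasd g w M ->
  hasd (fun z => f z + g z) w (fun h => L h + M h).
Proof.
move=> [df dE] [dg gE]; split; first exact: (differentiableD df dg).
by move=> h; rewrite -dE -gE (diffD df dg).
Qed.

Lemma hasdN f w L : hasd f w L -> hasd (fun z => - f z) w (fun h => - L h).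
Proof.
move=> [df dE]; split; first exact: (differentiableN df).
by move=> h; rewrite -dE (diffN df).
Qed.

Lemma hasdM f g w L M : hasd f w L -> hasd g w M ->
  hasd (fun z => f z * g z) w (fun h => f w * M h + g w * L h).
Proof.
move=> [df dE] [dg gE]; split; first exact: (differentiableM df dg).
by move=> h; rewrite -dE -gE (diffM df dg).
Qed.

Lemma hasdV f w L : hasd f w L -> f w != 0 ->
  hasd (fun z => (f z)^-1) w (fun h => - (f w) ^- 2 * L h).
Proof.
move=> [df dE] fw; split; first exact: (differentiableV df fw).
by move=> h; rewrite -dE (diffV df fw).
Qed.

Lemma hasdX2 f w L : hasd f w L ->
  hasd (fun z => f z ^+ 2) w (fun h => 2 * f w * L h).
Proof.
move=> hf; have := hasdM hf hf; rewrite /=.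
under eq_fun do rewrite -expr2.
by move=> /hasd_eq; apply=> h; ring.
Qed.

Lemma hasd_comp (U : normedModType K) (F : U -> V) f (u : U) L :
  differentiable F u -> hasd f (F u) L ->
  hasd (fun z => f (F z)) u (fun k => L ('d F u k)).
Proof.
move=> dF [df dE]; split; first exact: (differentiable_comp dF df).
by move=> k; rewrite (diff_comp dF df) /= dE.
Qed.

(** The first-order expansion of f at w is also one of g, since the two agree near w; uniqueness of
    the differential then identifies it. *)
Lemma near_hasd f g w L : {near w, f =1 g} -> hasd f w L -> hasd g w L.
Proof.
move=> fg [df dE].
have [dc fE] := (diff_locallyP _ _).1 df.
have gE : (g : V -> K^o) \o shift w
    = cst (g w : K^o) + 'd (f : V -> K^o) w +o_ 0 id.
  apply/eqaddoP => e e0; move/eqaddoP: fE => /(_ e e0) fE.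
  have fg0 : \forall h \near (0 : V), f (h + w) = g (h + w).
    by move: fg; rewrite (near_shift 0 w) /= subr0.
  near=> h; rewrite !fctE /=.
  have <- : f (h + w) = g (h + w) by near: h.
  have <- : f w = g w by exact: nbhs_singleton fg.
  by near: h.
have dg := diff_unique dc gE.
split; last by move=> h; rewrite dg.
by apply/diff_locallyP; rewrite dg.
Unshelve. all: by end_near. Qed.

End HasD.

Section Coord.
Context {K : numFieldType} {U1 U2 : normedModType K}.

Lemma diff_fst (w : U1 * U2) : is_diff w (fst : U1 * U2 -> U1) fst.
Proof.
have cf : continuous (fst : U1 * U2 -> U1) by move=> z; exact: cvg_fst.
apply: DiffDef; first exact: linear_differentiable.
by rewrite diff_lin.
Qed.

Lemma diff_snd (w : U1 * U2) : is_diff w (snd : U1 * U2 -> U2) snd.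
Proof.
have cf : continuous (snd : U1 * U2 -> U2) by move=> z; exact: cvg_snd.
apply: DiffDef; first exact: linear_differentiable.
by rewrite diff_lin.
Qed.

End Coord.

Section CoordK.
Context {K : numFieldType}.

Lemma hasd_id (w : K^o) : hasd (fun z : K^o => z) w (fun h => h).
Proof. by split=> // h; rewrite diff_val. Qed.

Lemma hasd_x2 (w : K^o * K^o) : hasd (fun z => z.1 : K) w (fun h => h.1).
Proof. by have [d e] := diff_fst w; split=> // h; rewrite e. Qed.

Lemma hasd_y2 (w : K^o * K^o) : hasd (fun z => z.2 : K) w (fun h => h.2).
Proof. by have [d e] := diff_snd w; split=> // h; rewrite e. Qed.

Lemma hasd_x3 (w : K^o * K^o * K^o) :
  hasd (fun z => z.1.1 : K) w (fun h => h.1.1).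
Proof.
have [d e] := diff_fst w.
have := hasd_comp d (hasd_x2 w.1); rewrite e => /hasd_eq; exact.
Qed.

Lemma hasd_y3 (w : K^o * K^o * K^o) :
  hasd (fun z => z.1.2 : K) w (fun h => h.1.2).
Proof.
have [d e] := diff_fst w.
have := hasd_comp d (hasd_y2 w.1); rewrite e => /hasd_eq; exact.
Qed.

Lemma hasd_z3 (w : K^o * K^o * K^o) :
  hasd (fun z => z.2 : K) w (fun h => h.2).
Proof. by have [d e] := diff_snd w; split=> // h; rewrite e. Qed.

End CoordK.

(* [refine] rather than [eapply]: only evarconv unifies the ring operations of [R[i]]
   with those derived from its numFieldType structure. *)
Ltac hasd_rules :=
  first
  [ eassumption
  | refine (hasd_cst _ _)
  | refine (hasd_x2 _) | refine (hasd_y2 _)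
  | refine (hasd_x3 _) | refine (hasd_y3 _) | refine (hasd_z3 _)
  | refine (hasd_id _)
  | refine (hasdX2 _); hasd_rules
  | refine (hasdD _ _); [hasd_rules | hasd_rules]
  | refine (hasdN _); hasd_rules
  | refine (hasdM _ _); [hasd_rules | hasd_rules]
  | refine (hasdV _ _); [hasd_rules | ] ].
Ltac hasd_auto := refine (hasd_eq _ _); [hasd_rules | move=> ?/=].

Lemma ord3P (k : 'I_3) : [\/ k = ord0, k = inord 1 | k = ord_max].
Proof.
case: k => -[|[|[|//]]] i; [constructor 1|constructor 2|constructor 3];
  by apply/val_inj; rewrite /= ?inordK.
Qed.

Lemma sum_ord3 (V : nmodType) (F : 'I_3 -> V) :
  \sum_(k < 3) F k = F ord0 + F (inord 1) + F ord_max.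
Proof.
rewrite !big_ord_recr big_ord0 /= add0r; congr (F _ + F _ + F _);
  by apply/val_inj; rewrite /= ?inordK.
Qed.

Lemma sum_ord2 (V : nmodType) (F : 'I_2 -> V) :
  \sum_(k < 2) F k = F ord0 + F ord_max.
Proof.
rewrite !big_ord_recr big_ord0 /= add0r; congr (F _ + F _); exact/val_inj.
Qed.

(** * The general cubic *)

(* The casts keep products of coordinates in [R[i]] instead of [R[i]^o]. *)
Notation x1 v := (v.1.1 : _[i]).
Notation x2 v := (v.1.2 : _[i]).
Notation x3 v := (v.2 : _[i]).

Definition cubic (R : realType) (A B p q c m : R[i]) (v : C3 R) : R[i] :=
  x1 v * x2 v * x3 v + A * x1 v ^+ 2 + B * x2 v ^+ 2
  + p * x1 v + q * x2 v + c * x3 v + m.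

Section Cubic.
Context {R : realType}.
Local Notation C := R[i].

Lemma coord3_0 (v : C3 R) : coord3 ord0 v = v.1.1. Proof. by []. Qed.
Lemma coord3_1 (v : C3 R) : coord3 (inord 1) v = v.1.2.
Proof. by rewrite /coord3 [val _]inordK. Qed.
Lemma coord3_2 (v : C3 R) : coord3 ord_max v = v.2. Proof. by []. Qed.
Definition coord3E := (coord3_0, coord3_1, coord3_2).

Lemma e3_0 : e3 R ord0 = ((1, 0), 0). Proof. by []. Qed.
Lemma e3_1 : e3 R (inord 1) = ((0, 1), 0).
Proof. by rewrite /e3 [val _]inordK. Qed.
Lemma e3_2 : e3 R ord_max = ((0, 0), 1). Proof. by []. Qed.
Definition e3E := (e3_0, e3_1, e3_2).

Context (A B p q c m : C).
Local Notation P := (cubic A B p q c m).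

Lemma hasd_cubic (v : C3 R) : hasd P v (fun h =>
  (x2 v * x3 v + 2 * A * x1 v + p) * x1 h
  + (x1 v * x3 v + 2 * B * x2 v + q) * x2 h + (x1 v * x2 v + c) * x3 h).
Proof. by rewrite /cubic; hasd_auto; ring. Qed.

Lemma Pd_cubic0 v : Pd P ord0 v = x2 v * x3 v + 2 * A * x1 v + p.
Proof. by rewrite /Pd e3E (hasd_derive _ (hasd_cubic v)) /=; ring. Qed.
Lemma Pd_cubic1 v : Pd P (inord 1) v = x1 v * x3 v + 2 * B * x2 v + q.
Proof. by rewrite /Pd e3E (hasd_derive _ (hasd_cubic v)) /=; ring. Qed.
Lemma Pd_cubic2 v : Pd P ord_max v = x1 v * x2 v + c.
Proof. by rewrite /Pd e3E (hasd_derive _ (hasd_cubic v)) /=; ring. Qed.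

End Cubic.

(** * Transversality through partial derivatives *)

Section Transversality.
Context {R : realType}.
Local Notation C := R[i].
Context (P : C3 R -> C^o).

Lemma tangentSE v h : tangentS P v h <->
  Pd P ord0 v * x1 h + Pd P (inord 1) v * x2 h + Pd P ord_max v * x3 h = 0.
Proof. by rewrite /tangentS sum_ord3 !coord3E. Qed.

(** The common kernel of dx and dy is spanned by the third basis vector, which is tangent to S
    exactly when P_z vanishes. The two next lemmas permute the coordinates. *)
Lemma transversalP01 v : Defs.transversal P ord0 (inord 1) v <-> Pd P ord_max v != 0.
Proof.
split=> [tr|nz [[h1 h2] h3]].
  apply/eqP => z0; have : ((0 : C, 0 : C), 1 : C) = 0 :> C3 R.
    apply: tr; rewrite ?coord3E //; apply/tangentSE; rewrite z0 /=.
    by move: (Pd P ord0 v) (Pd P (inord 1) v) => a b; ring.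
  by move/(congr1 (fun u : C3 R => x3 u)) => /= /eqP; rewrite oner_eq0.
move=> /tangentSE; rewrite !coord3E /= => t h10 h20; move: t; rewrite h10 h20.
move: (Pd P ord0 v) (Pd P (inord 1) v) (Pd P ord_max v) nz => a b d d0.
have -> : a * 0 + b * 0 + d * (h3 : C) = d * (h3 : C) by ring.
by move/eqP; rewrite mulf_eq0 (negbTE d0) => /eqP ->.
Qed.

Lemma transversalP02 v : Defs.transversal P ord0 ord_max v <-> Pd P (inord 1) v != 0.
Proof.
split=> [tr|nz [[h1 h2] h3]].
  apply/eqP => z0; have : ((0 : C, 1 : C), 0 : C) = 0 :> C3 R.
    apply: tr; rewrite ?coord3E //; apply/tangentSE; rewrite z0 /=.
    by move: (Pd P ord0 v) (Pd P ord_max v) => a b; ring.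
  by move/(congr1 (fun u : C3 R => x2 u)) => /= /eqP; rewrite oner_eq0.
move=> /tangentSE; rewrite !coord3E /= => t h10 h20; move: t; rewrite h10 h20.
move: (Pd P ord0 v) (Pd P ord_max v) (Pd P (inord 1) v) nz => a b d d0.
have -> : a * 0 + d * (h2 : C) + b * 0 = d * (h2 : C) by ring.
by move/eqP; rewrite mulf_eq0 (negbTE d0) => /eqP ->.
Qed.

Lemma transversalP12 v : Defs.transversal P (inord 1) ord_max v <-> Pd P ord0 v != 0.
Proof.
split=> [tr|nz [[h1 h2] h3]].
  apply/eqP => z0; have : ((1 : C, 0 : C), 0 : C) = 0 :> C3 R.
    apply: tr; rewrite ?coord3E //; apply/tangentSE; rewrite z0 /=.
    by move: (Pd P (inord 1) v) (Pd P ord_max v) => a b; ring.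
  by move/(congr1 (fun u : C3 R => x1 u)) => /= /eqP; rewrite oner_eq0.
move=> /tangentSE; rewrite !coord3E /= => t h10 h20; move: t; rewrite h10 h20.
move: (Pd P (inord 1) v) (Pd P ord_max v) (Pd P ord0 v) nz => a b d d0.
have -> : d * (h1 : C) + a * 0 + b * 0 = d * (h1 : C) by ring.
by move/eqP; rewrite mulf_eq0 (negbTE d0) => /eqP ->.
Qed.

Lemma transversal_sym i j v : Defs.transversal P i j v -> Defs.transversal P j i v.
Proof. by move=> tr h th hj hi; exact: tr. Qed.

Lemma S_webP v : S_web P v <-> [/\ P v = 0, Pd P ord0 v != 0,
  Pd P (inord 1) v != 0 & Pd P ord_max v != 0].
Proof.
have n01 : ord0 != inord 1 :> 'I_3 by apply/eqP => /(congr1 val); rewrite /= inordK.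
have n12 : inord 1 != ord_max :> 'I_3 by apply/eqP => /(congr1 val); rewrite /= inordK.
split.
  move=> [[P0 _] tr]; split => //.
  - exact/transversalP12/tr.
  - exact/transversalP02/tr.
  - exact/transversalP01/tr.
move=> [P0 d0 d1 d2]; split; first by split=> //; exists ord0.
have t01 := (transversalP01 v).2 d2.
have t02 := (transversalP02 v).2 d1.
have t12 := (transversalP12 v).2 d0.
move=> i j; case: (ord3P i) => ->; case: (ord3P j) => -> //; rewrite ?eqxx //;
  move=> _ //; exact: transversal_sym.
Qed.

Lemma S_pair02P v : S_pair P ord0 ord_max v <-> P v = 0 /\ Pd P (inord 1) v != 0.
Proof.
split=> [[[P0 _] /transversalP02] //|[P0 d1]].
by split; [split=> //; exists (inord 1)|exact/transversalP02].
Qed.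

End Transversality.

Lemma hasd_open_neq0 (K : numFieldType) (V : normedModType K) (f : V -> K)
    (L : V -> V -> K) : (forall w, hasd f w (L w)) -> open [set w | f w != 0].
Proof.
move=> fd; have cf : continuous (f : V -> K^o).
  by move=> w; apply: differentiable_continuous; case: (fd w).
apply: (@open_comp _ _ (f : V -> K^o) [set z : K^o | z != 0]).
  by move=> w _; exact: cf.
have -> : [set z : K^o | z != 0] = ~` [set (0 : K^o)].
  by apply/seteqP; split => z /= /eqP.
apply: closed_openC; apply: accessible_closed_set1; apply: hausdorff_accessible.
exact: (@norm_hausdorff K K^o).
Qed.

Lemma hasd_pair3 (K : numFieldType) (V : normedModType K) (f g h : V -> K) (w : V)
    (L M N : V -> K) : hasd f w L -> hasd g w M -> hasd h w N ->
  differentiable (fun z => ((f z : K^o, g z : K^o), h z : K^o)) w /\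
  forall v, 'd (fun z => ((f z : K^o, g z : K^o), h z : K^o)) w v
            = ((L v : K^o, M v : K^o), N v : K^o).
Proof.
move=> [df fE] [dg gE] [dh hE]; have d2 := differentiable_pair df dg.
split; first exact: differentiable_pair.
by move=> v; rewrite (diff_pair d2 dh) /= (diff_pair df dg) /= fE gE hE.
Qed.

(** * The surface as a graph over (x, y) *)

Notation wx w := (w.1 : _[i]).
Notation wy w := (w.2 : _[i]).

Section Graph.
Context {R : realType}.
Local Notation C := R[i].
Context (A B p q c m : C).

Definition graph_den (w : C2 R) : C := wx w * wy w + c.
Definition graph_num (w : C2 R) : C :=
  A * wx w ^+ 2 + B * wy w ^+ 2 + p * wx w + q * wy w + m.
Definition graph_z (w : C2 R) : C := - graph_num w / graph_den w.
(** [graph_P1] and [graph_P2] are P_x and P_y along the graph. [graph_N1] and [graph_N2] clear their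
    denominator, which makes them polynomials in (x, y), open to interpolation. *)
Definition graph_P1 (w : C2 R) : C := wy w * graph_z w + 2 * A * wx w + p.
Definition graph_P2 (w : C2 R) : C := wx w * graph_z w + 2 * B * wy w + q.
Definition graph_N1 (w : C2 R) : C :=
  - wy w * graph_num w + (2 * A * wx w + p) * graph_den w.
Definition graph_N2 (w : C2 R) : C :=
  - wx w * graph_num w + (2 * B * wy w + q) * graph_den w.

Lemma hasd_graph_den (w : C2 R) :
  hasd graph_den w (fun h => wy w * wx h + wx w * wy h).
Proof. by rewrite /graph_den; hasd_auto; ring. Qed.

Lemma hasd_graph_num (w : C2 R) : hasd graph_num w (fun h =>
  (2 * A * wx w + p) * wx h + (2 * B * wy w + q) * wy h).
Proof. by rewrite /graph_num; hasd_auto; ring. Qed.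

Lemma graph_P1_den (w : C2 R) : graph_den w != 0 ->
  graph_P1 w * graph_den w = graph_N1 w.
Proof. by rewrite /graph_P1 /graph_N1 /graph_z => ?; field. Qed.
Lemma graph_P2_den (w : C2 R) : graph_den w != 0 ->
  graph_P2 w * graph_den w = graph_N2 w.
Proof. by rewrite /graph_P2 /graph_N2 /graph_z => ?; field. Qed.

Definition graph_fx (w : C2 R) : C := - graph_P1 w / graph_den w.
Definition graph_fy (w : C2 R) : C := - graph_P2 w / graph_den w.

Lemma hasd_graph_z (w : C2 R) : graph_den w != 0 ->
  hasd graph_z w (fun h => graph_fx w * wx h + graph_fy w * wy h).
Proof.
move=> D0; have hD := hasd_graph_den w; have hQ := hasd_graph_num w.
rewrite /graph_z; hasd_auto => //.
by rewrite /graph_fx /graph_fy /graph_P1 /graph_P2 /graph_z; field.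
Qed.

Lemma hasd_graph_P1 (w : C2 R) : graph_den w != 0 -> hasd graph_P1 w (fun h =>
  (2 * A + wy w * graph_fx w) * wx h + (graph_z w + wy w * graph_fy w) * wy h).
Proof.
by move=> D0; have hz := hasd_graph_z D0; rewrite /graph_P1; hasd_auto; ring.
Qed.

Lemma hasd_graph_P2 (w : C2 R) : graph_den w != 0 -> hasd graph_P2 w (fun h =>
  (graph_z w + wx w * graph_fx w) * wx h + (2 * B + wx w * graph_fy w) * wy h).
Proof.
by move=> D0; have hz := hasd_graph_z D0; rewrite /graph_P2; hasd_auto; ring.
Qed.

(** The second derivatives of f come from differentiating the identity P(x, y, f(x, y)) = 0 twice
    and solving for the term multiplied by P_z. *)
Definition graph_fxx (w : C2 R) : C := - (2 * A + 2 * wy w * graph_fx w) / graph_den w.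
Definition graph_fxy (w : C2 R) : C :=
  - (graph_z w + wy w * graph_fy w + wx w * graph_fx w) / graph_den w.
Definition graph_fyy (w : C2 R) : C := - (2 * B + 2 * wx w * graph_fy w) / graph_den w.

Lemma hasd_graph_fx (w : C2 R) : graph_den w != 0 ->
  hasd graph_fx w (fun h => graph_fxx w * wx h + graph_fxy w * wy h).
Proof.
move=> D0; have hD := hasd_graph_den w; have h1 := hasd_graph_P1 D0.
rewrite {1}/graph_fx; hasd_auto => //.
rewrite /graph_fxx /graph_fxy /graph_fx.
move: (graph_fy w) (graph_P1 w) (graph_z w) => a b d; field; exact: D0.
Qed.

Lemma hasd_graph_fy (w : C2 R) : graph_den w != 0 ->
  hasd graph_fy w (fun h => graph_fxy w * wx h + graph_fyy w * wy h).
Proof.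
move=> D0; have hD := hasd_graph_den w; have h1 := hasd_graph_P2 D0.
rewrite {1}/graph_fy; hasd_auto => //.
rewrite /graph_fyy /graph_fxy /graph_fy.
move: (graph_fx w) (graph_P2 w) (graph_z w) => a b d; field; exact: D0.
Qed.

Definition graph (w : C2 R) : C3 R := ((w.1, w.2), graph_z w).

Lemma diff_graph (w : C2 R) : graph_den w != 0 -> differentiable graph w /\
  forall h : C2 R, 'd graph w h = ((h.1, h.2), graph_fx w * wx h + graph_fy w * wy h).
Proof.
move=> D0.
by have [? e] := hasd_pair3 (hasd_x2 w) (hasd_y2 w) (hasd_graph_z D0); split.
Qed.

Lemma cubic_graph (w : C2 R) : graph_den w != 0 -> cubic A B p q c m (graph w) = 0.
Proof. by move=> D0; rewrite /cubic /graph /= /graph_z /graph_num /graph_den; field. Qed.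

Lemma cubic_graph_z (v : C3 R) : graph_den v.1 != 0 -> cubic A B p q c m v = 0 ->
  v.2 = graph_z v.1.
Proof.
case: v => -[x y] z /=; rewrite /cubic /= /graph_z => D0 e.
apply: (mulIf D0); rewrite divfK //; apply/eqP; rewrite -subr_eq0; apply/eqP.
by rewrite -[RHS]e /graph_den /graph_num /=; ring.
Qed.

End Graph.


(** * The Hess connection of (F_1, F_3) *)

Section ConnectionCalculus.
Context {R : realType}.
Local Notation C := R[i].

Lemma e2_0 : e2 R ord0 = (1, 0). Proof. by []. Qed.
Lemma e2_1 : e2 R ord_max = (0, 1). Proof. by []. Qed.
Definition e2E := (e2_0, e2_1).

Lemma vderivE (X : C2 R -> C2 R) (g : C2 R -> C) w L : hasd g w L ->
  vderiv X g w = wx (X w) * L (1, 0) + wy (X w) * L (0, 1).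
Proof. by move=> hg; rewrite /vderiv sum_ord2 !e2E !(hasd_derive _ hg). Qed.

Lemma nablaE (G : Christoffel R) (X Y : C2 R -> C2 R) w L1 L2 :
  hasd (fun z => wx (Y z)) w L1 -> hasd (fun z => wy (Y z)) w L2 ->
  nabla G X Y w =
  (wx (X w) * (L1 (1, 0) + (wx (Y w) * G ord0 ord0 ord0 w
                            + wy (Y w) * G ord0 ord0 ord_max w))
   + wy (X w) * (L1 (0, 1) + (wx (Y w) * G ord0 ord_max ord0 w
                            + wy (Y w) * G ord0 ord_max ord_max w)),
   wx (X w) * (L2 (1, 0) + (wx (Y w) * G ord_max ord0 ord0 w
                            + wy (Y w) * G ord_max ord0 ord_max w))
   + wy (X w) * (L2 (0, 1) + (wx (Y w) * G ord_max ord_max ord0 w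
                            + wy (Y w) * G ord_max ord_max ord_max w))).
Proof.
move=> h1 h2; rewrite /nabla /mk2 !sum_ord2 !e2E.
by rewrite !(hasd_derive _ h1) !(hasd_derive _ h2).
Qed.

Lemma lieE (X Y : C2 R -> C2 R) w K1 K2 L1 L2 :
  hasd (fun z => wx (X z)) w K1 -> hasd (fun z => wy (X z)) w K2 ->
  hasd (fun z => wx (Y z)) w L1 -> hasd (fun z => wy (Y z)) w L2 ->
  lie X Y w =
  (wx (X w) * L1 (1, 0) + wy (X w) * L1 (0, 1)
   - (wx (Y w) * K1 (1, 0) + wy (Y w) * K1 (0, 1)),
   wx (X w) * L2 (1, 0) + wy (X w) * L2 (0, 1)
   - (wx (Y w) * K2 (1, 0) + wy (Y w) * K2 (0, 1))).
Proof.
move=> h1 h2 h3 h4; rewrite /lie /mk2.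
by rewrite (vderivE _ h1) (vderivE _ h2) (vderivE _ h3) (vderivE _ h4).
Qed.

Lemma hasd_fields (Y : C2 R -> C2 R) w : differentiable Y w ->
  exists L1 L2, hasd (fun z => wx (Y z)) w L1 /\ hasd (fun z => wy (Y z)) w L2.
Proof.
move=> dY; do 2!eexists; split; first exact: (hasd_comp dY (hasd_x2 _)).
exact: (hasd_comp dY (hasd_y2 _)).
Qed.

End ConnectionCalculus.

Section Hess.
Context {R : realType}.
Local Notation C := R[i].
Context (A B p q c m : C).
Local Notation P := (cubic A B p q c m : C3 R -> C^o).
Local Notation graph_den := (graph_den c).
Local Notation graph_z := (graph_z A B p q c m).
Local Notation graph_fx := (graph_fx A B p q c m).
Local Notation graph_fy := (graph_fy A B p q c m).
Local Notation graph_fxx := (graph_fxx A B p q c m).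
Local Notation graph_fxy := (graph_fxy A B p q c m).
Local Notation graph_fyy := (graph_fyy A B p q c m).
Local Notation graph_P1 := (graph_P1 A B p q c m).
Local Notation graph_P2 := (graph_P2 A B p q c m).
Local Notation graph_N2 := (graph_N2 A B p q c m).
Local Notation graph := (graph A B p q c m).

(* In the coordinates (x, z), d log P_y = hess_a dx + hess_b dz, and the Hess
   connection is characterized by nabla dx = hess_a dx (x) dx and
   nabla dz = hess_b dz (x) dz; [hess_conn] is its expression in (x, y). *)
Definition hess_a (w : C2 R) : C :=
  (2 * graph_z w * (wx w * graph_z w + q) - 4 * B * (2 * A * wx w + p))
  / (2 * graph_P2 w ^+ 2).
Definition hess_b (w : C2 R) : C :=
  (2 * wx w * (wx w * graph_z w + q) - 4 * B * c) / (2 * graph_P2 w ^+ 2).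

Definition hess_conn : Christoffel R := fun k a b w =>
  if val k == 0%N then if (val a == 0%N) && (val b == 0%N) then - hess_a w else 0
  else if val a == 0%N then
    if val b == 0%N then
      (graph_fxx w - hess_b w * graph_fx w ^+ 2 + graph_fx w * hess_a w) / graph_fy w
    else (graph_fxy w - hess_b w * graph_fx w * graph_fy w) / graph_fy w
  else if val b == 0%N then
    (graph_fxy w - hess_b w * graph_fx w * graph_fy w) / graph_fy w
  else (graph_fyy w - hess_b w * graph_fy w ^+ 2) / graph_fy w.

Definition hess_dom : set (C2 R) := [set w | graph_den w != 0 /\ graph_P2 w != 0].

Lemma hess_dom_fy w : hess_dom w -> graph_fy w != 0.
Proof. by move=> [D0 P0]; rewrite mulf_neq0 ?invr_eq0 // oppr_eq0. Qed.

(** P_y along the graph is rational, but [graph_N2] is polynomial and hence continuous everywhere,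
    so openness can be read off this form. *)
Lemma hess_domE : hess_dom = [set w | graph_den w != 0] `&` [set w | graph_N2 w != 0].
Proof.
apply/seteqP; split => w [/= D0].
  by move=> P0; split=> //=; rewrite -graph_P2_den // mulf_neq0.
by rewrite -graph_P2_den // mulf_eq0 negb_or => /andP[].
Qed.

Lemma hess_dom_open : open hess_dom.
Proof.
rewrite hess_domE; apply: openI; first exact: hasd_open_neq0 (hasd_graph_den c).
have hN w : exists L, hasd graph_N2 w L.
  have hD := hasd_graph_den c w; have hQ := hasd_graph_num A B p q m w.
  by eexists; rewrite /graph_N2; hasd_rules.
exact: (hasd_open_neq0 (fun w => svalP (cid (hN w)))).
Qed.

Lemma hess_chart : is_chart (S_pair P ord0 ord_max) hess_dom graph.
Proof.
split; first exact: hess_dom_open.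
- by move=> w [D0 _]; case: (diff_graph A B p q m D0).
- by move=> w w' _ _; case: w => a b; case: w' => a' b' [-> ->].
- move=> w [D0 _] [h1 h2]; case: (diff_graph A B p q m D0) => _ -> /=.
  by case=> -> ->.
(* P is affine in z, so over this open set S is exactly the graph. *)
exists [set v | graph_den v.1 != 0]; split.
  apply: (@open_comp _ _ (fst : C3 R -> C2 R) [set w | graph_den w != 0]).
    by move=> v _; exact: cvg_fst.
  exact: hasd_open_neq0 (hasd_graph_den c).
apply/seteqP; split => [_ [w [D0 P0] <-]|v [/= D0 /S_pair02P[P0 P2]]].
  split=> //; apply/S_pair02P; split; first exact: cubic_graph.
  by rewrite Pd_cubic1.
have e := cubic_graph_z D0 P0; exists v.1; last first.
  by case: v D0 P0 P2 e => -[x y] z /= D0 P0 P2 ->.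
by split=> //; move: P2; rewrite Pd_cubic1 e.
Qed.

Lemma Omega_graph w (U V : C3 R) : graph_den w != 0 ->
  Omega P (graph w) U V = (x1 U * x2 V - x2 U * x1 V) / graph_den w.
Proof.
by move=> D0; rewrite /Omega Pd_cubic2 !coord3E /= ifT.
Qed.

Lemma hasd_hess_conn k a b w : hess_dom w -> exists L, hasd (hess_conn k a b) w L.
Proof.
move=> ww; have fy0 := hess_dom_fy ww; case: ww => D0 P0.
have P20 : 2 * graph_P2 w ^+ 2 != 0 by rewrite mulf_neq0 ?expf_neq0 // pnatr_eq0.
have hz := hasd_graph_z A B p q m D0; have hx := hasd_graph_fx A B p q m D0.
have hy := hasd_graph_fy A B p q m D0; have hD := hasd_graph_den c w.
have hP2 := hasd_graph_P2 A B p q m D0.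
have [La ha] : exists L, hasd hess_a w L by eexists; rewrite /hess_a; hasd_rules.
have [Lb hb] : exists L, hasd hess_b w L by eexists; rewrite /hess_b; hasd_rules.
have [Lxx hxx] : exists L, hasd graph_fxx w L by eexists; rewrite /graph_fxx; hasd_rules.
have [Lxy hxy] : exists L, hasd graph_fxy w L by eexists; rewrite /graph_fxy; hasd_rules.
have [Lyy hyy] : exists L, hasd graph_fyy w L by eexists; rewrite /graph_fyy; hasd_rules.
rewrite /hess_conn.
by case: (val k == 0%N); case: (val a == 0%N); case: (val b == 0%N) => /=;
  eexists; hasd_rules.
Qed.

(** Omega = dx /\ dy / D is parallel exactly when the traces of the Christoffel symbols are the
    logarithmic derivatives of 1 / D; this lemma and the next check the two traces. *)
Lemma hess_conn_traceX w : hess_dom w ->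
  - hess_a w + (graph_fxy w - hess_b w * graph_fx w * graph_fy w) / graph_fy w
  = - wy w / graph_den w.
Proof.
move=> [D0 P0]; move: (D0) (P0).
rewrite /hess_a /hess_b /graph_fxy /graph_fy /graph_fx /graph_P1 /graph_P2 /graph_den.
by move: (graph_z w) => z D1 P2; field; rewrite ?oppr_eq0 ?D1 ?P2.
Qed.

Lemma hess_conn_traceY w : hess_dom w ->
  (graph_fyy w - hess_b w * graph_fy w ^+ 2) / graph_fy w = - wx w / graph_den w.
Proof.
move=> [D0 P0]; move: (D0) (P0).
rewrite /hess_a /hess_b /graph_fyy /graph_fy /graph_fx /graph_P1 /graph_P2 /graph_den.
by move: (graph_z w) => z D1 P2; field; rewrite ?oppr_eq0 ?D1 ?P2.
Qed.

Lemma push_graph (Y : C2 R -> C2 R) w : hess_dom w ->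
  push graph Y w = (((Y w).1, (Y w).2),
                    graph_fx w * wx (Y w) + graph_fy w * wy (Y w)).
Proof. by move=> [D0 _]; rewrite /push; case: (diff_graph A B p q m D0). Qed.

Lemma near_hess_dom w : hess_dom w -> \forall z \near w, hess_dom z.
Proof. by move=> ww; apply: open_nbhs_nbhs; split=> //; exact: hess_dom_open. Qed.

(** Turns the tangency of a field on the whole open domain into conditions on its first
    derivatives. *)
Lemma near_derive0 (g : C2 R -> C) w L : hess_dom w ->
  (forall z, hess_dom z -> g z = 0) -> hasd g w L -> forall h, L h = 0.
Proof.
move=> ww g0 hg h; rewrite -(hasd_derive h hg).
rewrite (@near_eq_derive _ _ _ _ (fun=> 0 : C^o)) ?derive_cst //.
by near do apply: g0; exact: near_hess_dom.
Unshelve. all: by end_near. Qed.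

Lemma is_hess_conn : is_hess P ord0 ord_max hess_dom graph hess_conn.
Proof.
split.
- by move=> k a b w /(hasd_hess_conn k a b) [L []].
- move=> X Y dX dY w ww.
  have [K1 [K2 [h1 h2]]] := hasd_fields (dX w ww).
  have [L1 [L2 [h3 h4]]] := hasd_fields (dY w ww).
  rewrite (nablaE _ _ h3 h4) (nablaE _ _ h1 h2) (lieE h1 h2 h3 h4).
  rewrite /hess_conn /=.
  apply/eqP; rewrite xpair_eqE; apply/andP; split; apply/eqP => /=.
    move: (X w) (Y w) (hess_a w) => [X1 X2] [Y1 Y2] a /=; ring.
  move: (X w) (Y w) => [X1 X2] [Y1 Y2] /=.
  move: (_ / _) (_ / _) (_ / _) => a1 a2 a3; ring.
- move=> X Y Z dX dY dZ w ww.
  have [L1 [L2 [h3 h4]]] := hasd_fields (dY w ww).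
  have [M1 [M2 [h5 h6]]] := hasd_fields (dZ w ww).
  have D0 := ww.1; have hD := hasd_graph_den c w.
  have [L [hL LE]] : exists L, hasd (fun z =>
      (wx (Y z) * wy (Z z) - wy (Y z) * wx (Z z)) / graph_den z) w L /\
      forall h, L h = (wx (Y w) * M2 h + wy (Z w) * L1 h
        - (wy (Y w) * M1 h + wx (Z w) * L2 h)) / graph_den w
       - (wx (Y w) * wy (Z w) - wy (Y w) * wx (Z w)) / graph_den w ^+ 2
         * (wy w * wx h + wx w * wy h).
    eexists; split; first by hasd_rules.
    by move=> h /=; field.
  have hO : hasd (fun z => Omega P (graph z) (push graph Y z) (push graph Z z)) w L.
    apply: near_hasd hL; near=> z.
    have wz : hess_dom z by near: z; exact: near_hess_dom.
    by rewrite !push_graph // Omega_graph ?wz.1.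
  rewrite (vderivE _ hO) !LE !Omega_graph ?ww.1 // !push_graph //.
  rewrite (nablaE _ _ h3 h4) (nablaE _ _ h5 h6) /hess_conn /=.
  (* Parallelism of Omega sees only the traces of the symbols, so [s] and [t] are eliminated while
     [a] and [u] stay arbitrary. *)
  have := hess_conn_traceX ww; have := hess_conn_traceY ww.
  move: (hess_a w) ((graph_fxy w - _) / _) ((graph_fyy w - _) / _)
    ((graph_fxx w - _ + _) / _) => a s t u.
  move=> -> /(canRL (addKr _)) ->.
  move: (X w) (Y w) (Z w) => [X1 X2] [Y1 Y2] [Z1 Z2] /=.
  by field.
- move=> l; rewrite !inE => /orP[] /eqP -> X Y dX dY Y0 w ww;
    have [L1 [L2 [h3 h4]]] := hasd_fields (dY w ww);
    rewrite push_graph // (nablaE _ _ h3 h4) coord3E /hess_conn /=.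
    have Y10 z : hess_dom z -> wx (Y z) = 0.
      by move=> wz; have := Y0 z wz; rewrite push_graph.
    rewrite !(near_derive0 ww Y10 h3) (Y10 _ ww).
    move: (X w) (Y w) => [X1 X2] [Y1 Y2] /=; ring.
  (* Tangency to F_3 is f_x Y1 + f_y Y2 = 0. Its two partial derivatives determine those of Y2, and
     the relation itself determines Y2, since f_y is nonzero. *)
  have Yz z : hess_dom z -> graph_fx z * wx (Y z) + graph_fy z * wy (Y z) = 0.
    by move=> wz; have := Y0 z wz; rewrite push_graph.
  have hx := hasd_graph_fx A B p q m ww.1; have hy := hasd_graph_fy A B p q m ww.1.
  have hL := hasdD (hasdM hx h3) (hasdM hy h4).
  have := near_derive0 ww Yz hL => {hL} L0.
  have := L0 (1, 0); have := L0 (0, 1); have := Yz _ ww; rewrite /=.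
  have := hess_dom_fy ww.
  move: (hess_a w) (hess_b w) (graph_fxx w) (graph_fxy w) (graph_fyy w)
    (graph_fx w) (graph_fy w) => a b f1 f2 f3 g1 g2.
  move: (X w) (Y w) => [X1 X2] [Y1 Y2] /= g20 e1 e2 e3.
  have -> : L2 (1, 0) = (- g1 * L1 (1, 0) - f1 * (Y1 : C) - f2 * (Y2 : C)) / g2.
    apply: (mulIf g20); rewrite divfK //; apply/eqP; rewrite -subr_eq0.
    by apply/eqP; rewrite -[RHS]e3; ring.
  have -> : L2 (0, 1) = (- g1 * L1 (0, 1) - f2 * (Y1 : C) - f3 * (Y2 : C)) / g2.
    apply: (mulIf g20); rewrite divfK //; apply/eqP; rewrite -subr_eq0.
    by apply/eqP; rewrite -[RHS]e2; ring.
  have -> : (Y2 : C) = - g1 * (Y1 : C) / g2.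
    apply: (mulIf g20); rewrite divfK //; apply/eqP; rewrite -subr_eq0.
    by apply/eqP; rewrite -[RHS]e1; ring.
  by field.
Unshelve. all: by end_near. Qed.

(** This is Delta_xz Delta - Delta_x Delta_z on the graph, with P_y^2 in place of Delta: the
    numerator of the mixed derivative of log Delta in (x, z). *)
Definition nonflat_num (w : C2 R) : C :=
  (4 * wx w * graph_z w + 2 * q) * graph_P2 w ^+ 2
  - (2 * graph_z w * (wx w * graph_z w + q) - 4 * B * (2 * A * wx w + p))
    * (2 * wx w * (wx w * graph_z w + q) - 4 * B * c).

(** As a function of (x, z), [hess_a] is Delta_x / (2 Delta); differentiating it in y at fixed x
    gives f_y times its z-derivative. *)
Lemma hasd_hess_a w : hess_dom w -> exists L, hasd hess_a w L /\
  L (0, 1) = graph_fy w * nonflat_num w / (2 * graph_P2 w ^+ 4).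
Proof.
move=> [D0 P0].
have P20 : 2 * graph_P2 w ^+ 2 != 0 by rewrite mulf_neq0 ?expf_neq0 // pnatr_eq0.
have hz := hasd_graph_z A B p q m D0; have hP2 := hasd_graph_P2 A B p q m D0.
eexists; split; first by rewrite /hess_a; hasd_rules.
move: (D0) (P0); rewrite /nonflat_num /graph_fy /= /graph_P2 /graph_den.
by move: (graph_z w) => z D1 P2; field; rewrite ?D1 ?P2.
Qed.

(** The first component of R(d_x, d_y) d_x is the y-derivative of [hess_a], because the only symbol
    with upper index x that is not zero is - [hess_a]. *)
Lemma hess_not_flat w : hess_dom w -> nonflat_num w != 0 ->
  ~ hess_flat P ord0 ord_max.
Proof.
move=> ww nz fl.
have := fl _ _ _ hess_chart is_hess_conn.
have cst_holo (e : C2 R) : holo_field hess_dom (fun=> e).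
  by move=> z _; exact: differentiable_cst.
move=> /(_ _ _ _ (cst_holo (1, 0)) (cst_holo (0, 1)) (cst_holo (1, 0)) w ww).
have [La [ha aE]] := hasd_hess_a ww.
have [Lu hu] := hasd_hess_conn ord_max ord0 ord0 ww.
have [Lv hv] := hasd_hess_conn ord_max ord_max ord0 ww.
have h0 (e : C) z : hasd (fun _ : C2 R => e) z (fun=> 0) by exact: hasd_cst.
rewrite /curvature.
have -> : nabla hess_conn (fun=> (0, 1) : C2 R) (fun=> (1, 0) : C2 R) =
   (fun z => (0, hess_conn ord_max ord_max ord0 z) : C2 R).
  apply/funext => z; rewrite (@nablaE _ _ _ (fun=> (1, 0)) z _ _ (h0 1 z) (h0 0 z)) /=.
  by congr (_, _); [rewrite /hess_conn /=|]; ring.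
have -> : nabla hess_conn (fun=> (1, 0) : C2 R) (fun=> (1, 0) : C2 R) =
   (fun z => (- hess_a z, hess_conn ord_max ord0 ord0 z) : C2 R).
  apply/funext => z; rewrite (@nablaE _ _ _ (fun=> (1, 0)) z _ _ (h0 1 z) (h0 0 z)) /=.
  by congr (_, _); [rewrite /hess_conn /=|]; ring.
rewrite (@nablaE _ _ _ (fun z => (0, hess_conn ord_max ord_max ord0 z)) w _ _ (h0 0 w) hv).
rewrite (@nablaE _ _ _ (fun z => (- hess_a z, hess_conn ord_max ord0 ord0 z)) w _ _ (hasdN ha) hu).
rewrite (@nablaE _ _ _ (fun=> (1, 0)) w _ _ (h0 1 w) (h0 0 w)).
rewrite (@lieE _ (fun=> (1, 0)) (fun=> (0, 1)) w _ _ _ _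
  (h0 1 w) (h0 0 w) (h0 0 w) (h0 1 w)).
move=> /(congr1 (fun u : C2 R => wx u)) /=.
rewrite aE /hess_conn /= => e; have : graph_fy w * nonflat_num w / (2 * graph_P2 w ^+ 4) = 0.
  by rewrite -[RHS]e; ring.
have fy0 := hess_dom_fy ww; have P0 := ww.2; apply/eqP.
apply: mulf_neq0; first exact: mulf_neq0.
by rewrite invr_eq0 mulf_neq0 ?expf_neq0 ?pnatr_eq0.
Qed.

End Hess.

(** * Polynomial functions and a point of nonzero curvature *)

Definition polyfun (K : numFieldType) (F : K -> K) : Prop :=
  exists p : {poly K}, forall x, F x = p.[x].

Section PolyFun.
Context {K : numFieldType}.
Implicit Types (F G : K -> K).

Lemma polyfun_cst (a : K) : polyfun (fun=> a).
Proof. by exists a%:P => x; rewrite hornerC. Qed.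

Lemma polyfun_id : polyfun (fun x : K => x).
Proof. by exists 'X => x; rewrite hornerX. Qed.

Lemma polyfunD F G : polyfun F -> polyfun G -> polyfun (fun x => F x + G x).
Proof. by move=> [p pE] [r rE]; exists (p + r) => x; rewrite hornerD pE rE. Qed.

Lemma polyfunN F : polyfun F -> polyfun (fun x => - F x).
Proof. by move=> [p pE]; exists (- p) => x; rewrite hornerN pE. Qed.

Lemma polyfunM F G : polyfun F -> polyfun G -> polyfun (fun x => F x * G x).
Proof. by move=> [p pE] [r rE]; exists (p * r) => x; rewrite hornerM pE rE. Qed.

Lemma polyfunX F n : polyfun F -> polyfun (fun x => F x ^+ n).
Proof. by move=> [p pE]; exists (p ^+ n) => x; rewrite horner_exp pE. Qed.

Lemma poly_eq0_inj (p : {poly K}) (u : nat -> K) : injective u ->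
  (forall n, p.[u n] = 0) -> p = 0.
Proof.
move=> uI u0; apply/eqP; apply: contraT => p0.
have ur : all (root p) (map u (iota 0 (size p))).
  by apply/allP => _ /mapP[n _ ->]; rewrite /root u0.
have uu : uniq (map u (iota 0 (size p))) by rewrite map_inj_uniq ?iota_uniq.
by have := max_poly_roots p0 ur uu; rewrite size_map size_iota ltnn.
Qed.

Lemma polyfun_eq0 F (u : nat -> K) : polyfun F -> injective u ->
  (forall n, F (u n) = 0) -> forall x, F x = 0.
Proof.
move=> [p pE] uI u0 x; suff p0 : p = 0 by rewrite pE p0 horner0.
by apply: (poly_eq0_inj uI) => n; rewrite -pE.
Qed.

(** A product of nonzero polynomials is nonzero, so some natural number is a root of neither. This
    merges generic conditions one after the other. *)
Lemma polyfun_neq0M F G a b : polyfun F -> polyfun G -> F a != 0 -> G b != 0 ->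
  exists x, F x != 0 /\ G x != 0.
Proof.
move=> [p pE] [r rE] Fa Gb; apply: contrapT => /forallNP /= h.
have uI : injective (fun n => n%:R : K).
  by move=> n k /eqP; rewrite eqr_nat => /eqP.
have : p * r = 0.
  apply: (poly_eq0_inj uI) => n; rewrite hornerM -pE -rE; apply: contrapT => /eqP.
  by rewrite mulf_eq0 negb_or => /andP; exact: h.
move=> /eqP; rewrite mulf_eq0 => /orP[] /eqP e.
  by move: Fa; rewrite pE e horner0 eqxx.
by move: Gb; rewrite rE e horner0 eqxx.
Qed.

End PolyFun.

Ltac polyfun_rules :=
  first
  [ refine (polyfun_cst _)
  | refine polyfun_id
  | refine (polyfunX _ _); polyfun_rules
  | refine (polyfunD _ _); [polyfun_rules | polyfun_rules]
  | refine (polyfunN _); polyfun_rules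
  | refine (polyfunM _ _); [polyfun_rules | polyfun_rules] ].

Section NonflatPoint.
Context {R : realType}.
Local Notation C := R[i].
Context (A B p q c m : C).

(* [disc] is Delta, [nonflat_poly] is Delta_xz Delta - Delta_x Delta_z, and [resz x] is
   x^2 P(x, -c/x, z), whose nonvanishing keeps P_z nonzero on the line x = const. *)
Definition disc (x z : C) : C :=
  (x * z + q) ^+ 2 - 4 * B * (A * x ^+ 2 + p * x + c * z + m).
Definition nonflat_poly (x z : C) : C := (4 * x * z + 2 * q) * disc x z
  - (2 * z * (x * z + q) - 4 * B * (2 * A * x + p))
    * (2 * x * (x * z + q) - 4 * B * c).
Definition resz (x : C) : C :=
  A * x ^+ 4 + p * x ^+ 3 + m * x ^+ 2 - q * c * x + B * c ^+ 2.

(* Coefficients of the polynomial are recovered by finite differences. *)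
Lemma nonflat_poly_neq0 : [\/ q != 0, B * p != 0, B * c != 0 | B * m != 0] ->
  exists x z, nonflat_poly x z != 0.
Proof.
move=> H; apply: contrapT => /forallNP /= nz.
have n0 x z : nonflat_poly x z = 0.
  by have /forallNP/(_ z)/negP := nz x; rewrite negbK => /eqP.
pose l2 z : C := nonflat_poly 1 z + nonflat_poly (-1) z - 2 * nonflat_poly 0 z.
pose l1 z : C := nonflat_poly 1 z - nonflat_poly (-1) z.
have l20 z : l2 z = 0 by rewrite /l2 !n0; ring.
have l10 z : l1 z = 0 by rewrite /l1 !n0; ring.
have q0 : q = 0.
  have : 8 * q = l2 1 + l2 (-1) - 2 * l2 0 by rewrite /l2 /nonflat_poly /disc; ring.
  rewrite !l20 mulr0 subr0 addr0 => /eqP; rewrite mulf_eq0 pnatr_eq0 /=.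
  by move/eqP.
case: H; first by rewrite q0 eqxx.
- apply/negP; rewrite negbK.
  have : 32 * (B * p) = l2 (-1) - l2 1 by rewrite /l2 /nonflat_poly /disc; ring.
  by rewrite !l20 subr0 => /eqP; rewrite mulf_eq0 pnatr_eq0.
- apply/negP; rewrite negbK.
  have : 32 * (B * c) = 2 * l1 0 - l1 (-1) - l1 1 by rewrite /l1 /nonflat_poly /disc; ring.
  by rewrite !l10 mulr0 !subr0 => /eqP; rewrite mulf_eq0 pnatr_eq0.
- apply/negP; rewrite negbK.
  have : 64 * (B * m) = l1 (-1) - l1 1 + 16 * q ^+ 2 by rewrite /l1 /nonflat_poly /disc; ring.
  rewrite !l10 q0 expr0n /= mulr0 subr0 addr0 => /eqP.
  by rewrite mulf_eq0 pnatr_eq0.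
Qed.

(** A fourth difference in x isolates A, and an odd third difference isolates p. *)
Lemma resz_neq0 : A != 0 \/ p != 0 -> exists x, resz x != 0.
Proof.
move=> H; apply: contrapT => /forallNP /= nz.
have n0 x : resz x = 0 by have /negP := nz x; rewrite negbK => /eqP.
case: H; apply/negP; rewrite negbK.
- have : 24 * A = resz 2 - 4 * resz 1 + 6 * resz 0 - 4 * resz (-1) + resz (-2).
    by rewrite /resz; ring.
  by rewrite !n0 !(mulr0, subr0, addr0) => /eqP; rewrite mulf_eq0 pnatr_eq0.
- have : 12 * p = resz 2 - 2 * resz 1 + 2 * resz (-1) - resz (-2).
    by rewrite /resz; ring.
  by rewrite !n0 !(mulr0, subr0, addr0) => /eqP; rewrite mulf_eq0 pnatr_eq0.
Qed.

(** A generic z is chosen first, then a generic x, and P = 0 is solved for y. The conditions on x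
    and z ensure D and P_y are nonzero at the resulting point. *)
Lemma exists_nonflat : [\/ q != 0, B * p != 0, B * c != 0 | B * m != 0] ->
  A != 0 \/ p != 0 ->
  exists w, hess_dom A B p q c m w /\ nonflat_num A B p q c m w != 0.
Proof.
move=> /nonflat_poly_neq0 [x0 [z0 n0]] /resz_neq0 [x1 r1].
(* z^2 - 4AB is the coefficient of x^2 in [disc x z], so this choice keeps [disc] nonzero as a
   polynomial in x. *)
have [z [nz zz]] : exists z, nonflat_poly x0 z != 0 /\ z ^+ 2 * (z ^+ 2 - 4 * A * B) != 0.
  have [s [s1 s2]] : exists s : C, s != 0 /\ s ^+ 2 - 4 * A * B != 0.
    have [/eqP e|] := boolP ((1 : C) ^+ 2 - 4 * A * B == 0); last first.
      by exists 1; rewrite oner_eq0.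
    (* If s = 1 fails then 4AB = 1, and s = 2 gives 3. *)
    exists 2; rewrite pnatr_eq0; split=> //.
    have -> : (2 : C) ^+ 2 - 4 * A * B = 3 + (1 ^+ 2 - 4 * A * B) by ring.
    by rewrite e addr0 pnatr_eq0.
  apply: (@polyfun_neq0M _ (nonflat_poly x0) (fun z => z ^+ 2 * (z ^+ 2 - 4 * A * B)) z0 s) => //.
  - by rewrite /nonflat_poly /disc; polyfun_rules.
  - by polyfun_rules.
  - by rewrite mulf_neq0 // expf_neq0.
have [x2 d2] : exists x, disc x z != 0.
  apply: contrapT => /forallNP /= dz.
  have d0 x : disc x z = 0 by have /negP := dz x; rewrite negbK => /eqP.
  have : 2 * (z ^+ 2 - 4 * A * B) = disc 1 z + disc (-1) z - 2 * disc 0 z.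
    by rewrite /disc; ring.
  rewrite !d0 mulr0 subr0 addr0 => /eqP; rewrite mulf_eq0 pnatr_eq0 /= => /eqP e.
  by move: zz; rewrite e mulr0 eqxx.
have [x3 [x3n x3d]] : exists x, nonflat_poly x z != 0 /\ disc x z != 0.
  by apply: (@polyfun_neq0M _ (nonflat_poly^~ z) (disc^~ z) x0 x2) => //;
    rewrite /nonflat_poly /disc; polyfun_rules.
have [x4 [x4r x40]] : exists x, resz x != 0 /\ x != 0.
  apply: (@polyfun_neq0M _ resz id x1 1) => //; last exact: polyfun_id.
  by rewrite /resz; polyfun_rules.
have [x [xnd xr0]] : exists x, nonflat_poly x z * disc x z != 0 /\ resz x * x != 0.
  apply: (@polyfun_neq0M _ (fun x => nonflat_poly x z * disc x z) (fun x => resz x * x) x3 x4).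
  - by rewrite /nonflat_poly /disc; polyfun_rules.
  - by rewrite /resz; polyfun_rules.
  - by rewrite mulf_neq0.
  - by rewrite mulf_neq0.
move: xnd xr0; rewrite !mulf_eq0 !negb_or => /andP[xn xd] /andP[xr xx].
(* For B = 0 the equation is linear in y, with Delta = (xz + q)^2 nonzero; otherwise the quadratic
   formula applies. *)
have [y yE] : exists y, B * y ^+ 2 + (x * z + q) * y
    + (A * x ^+ 2 + p * x + c * z + m) = 0.
  have [B0|B0] := eqVneq B 0.
    exists (- (A * x ^+ 2 + p * x + c * z + m) / (x * z + q)).
    rewrite B0; field; move: xd; rewrite /disc B0 mulr0 mul0r subr0.
    by rewrite expf_eq0.
  exists ((sqrtc (disc x z) - (x * z + q)) / (2 * B)).
  have : sqrtc (disc x z) ^+ 2 - disc x z = 0 by rewrite sqr_sqrtc subrr.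
  move: (sqrtc _) => s; rewrite /disc => e.
  apply: (mulfI (_ : 4 * B != 0)); first by rewrite mulf_neq0 // pnatr_eq0.
  by rewrite mulr0 -[RHS]e; field.
have D0 : graph_den c (x, y) != 0.
  apply: contraNneq xr => /= D0; rewrite /graph_den /= in D0.
  have {}D0 : c = - (x * y) by apply/eqP; rewrite -addr_eq0 addrC D0.
  have -> : resz x = x ^+ 2 * (B * y ^+ 2 + (x * z + q) * y
    + (A * x ^+ 2 + p * x + c * z + m)) by rewrite /resz D0; ring.
  by rewrite yE mulr0.
have zE : graph_z A B p q c m (x, y) = z.
  apply/esym; apply: (@cubic_graph_z _ A B p q c m ((x, y), z)) => //.
  by rewrite /cubic /= -[RHS]yE; ring.
(* P_y^2 - Delta = 4 B P, and P vanishes at the chosen point. *)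
have P2E : graph_P2 A B p q c m (x, y) ^+ 2 = disc x z.
  rewrite /graph_P2 zE /= /disc; apply/eqP; rewrite -subr_eq0; apply/eqP.
  by rewrite -[RHS](mulr0 (4 * B)) -yE; ring.
exists (x, y); split; last by rewrite /nonflat_num P2E zE.
by split=> //; rewrite -sqrf_eq0 P2E.
Qed.

End NonflatPoint.

(** * Non-parallelizability *)

Section RealLine.
Local Open Scope complex_scope.
Context {R : realType}.
Local Notation C := R[i].

(** Restricts a complex limit to real increments, so that real calculus applies along a segment. *)
Lemma near_real_complex (P : C -> Prop) : (\forall s \near (0 : C^o)^', P s) ->
  \forall h \near (0 : R)^', P h%:C.
Proof.
move=> /nbhs_ballP[/= e e0 H]; apply/nbhs_ballP.
have eE : (complex.Re e)%:C = e by apply: RRe_real; exact: gtr0_real.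
have re0 : 0 < complex.Re e by rewrite -ltcR eE.
exists (complex.Re e) => //= h; rewrite -ball_normE /= sub0r normrN => hh h0.
apply: H; last by move: h0; apply: contra_neq => /complexI.
rewrite -ball_normE /= sub0r normrN -eE normc_def /= expr0n addr0 sqrtr_sqr.
by rewrite ltcR.
Qed.

Lemma Re_real_mul (r : R) (z : C) : complex.Re (r%:C * z) = r * complex.Re z.
Proof. by case: z => a b /=; rewrite mul0r subr0. Qed.

Lemma Re_diff_quotient (h : R) (a b : C) :
  complex.Re ((h%:C)^-1 * (a - b)) = h^-1 * (complex.Re a - complex.Re b).
Proof. by rewrite -fmorphV Re_real_mul; case: a; case: b. Qed.

Context {V : normedModType C}.

Lemma hasd_is_derive_Re (g : V -> C) (w d : V) (t : R) L :
  hasd g (w + t%:C *: d) L -> L d = 0 ->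
  is_derive t 1 (fun s : R => complex.Re (g (w + s%:C *: d))) 0.
Proof.
move=> hg L0; set x := w + _ in hg.
have cv : (fun s : C => s^-1 *: ((g (s *: d + x) : C^o) - g x)) @ (0 : C^o)^' --> (0 : C^o).
  have dg := diff_derivable (v := d) hg.1.
  suff : (fun s : C => s^-1 *: ((g (s *: d + x) : C^o) - g x)) @ (0 : C^o)^'
      --> derive (g : V -> C^o) x d by rewrite (hasd_derive d hg) L0.
  exact: dg.
have cvk : h^-1 *: (complex.Re (g (w + (h *: 1 + t)%:C *: d)) - complex.Re (g (w + t%:C *: d)))
    @[h --> (0 : R)^'] --> (0 : R).
  apply/cvgrPdist_lt => e e0.
  have e0C : 0 < e%:C by rewrite ltcR.
  move/cvgrPdist_lt: cv => /(_ _ e0C) /near_real_complex.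
  apply: filterS => h /=; rewrite !sub0r !normrN => H.
  have E : w + (h *: 1 + t)%:C *: d = h%:C *: d + x.
    by rewrite /x -[h *: 1]/(h * 1) mulr1 rmorphD /= scalerDl addrCA.
  rewrite E -ltcR; apply: le_lt_trans H; apply: le_trans (normc_ge_Re _).
  rewrite lecR le_eqVlt; apply/orP; left; apply/eqP; congr (`|_|).
  by apply/esym; exact: Re_diff_quotient.
apply: DeriveDef; first by apply/cvg_ex; exists 0.
exact: cvg_lim cvk.
Qed.

Lemma hasd0_Re (g : V -> C) (w d : V) :
  (forall t : R, 0 <= t <= 1 -> exists L, hasd g (w + t%:C *: d) L /\ L d = 0) ->
  complex.Re (g (w + d)) = complex.Re (g w).
Proof.
move=> H; pose k (t : R) := complex.Re (g (w + t%:C *: d)).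
have dk (t : R) : 0 <= t <= 1 -> is_derive t 1 k 0.
  by move=> /H[L [hL L0]]; exact: hasd_is_derive_Re hL L0.
have [||t _] := @MVT_segment R k (fun=> 0) 0 1 ler01.
- by move=> t /itvP tt; apply: dk; rewrite !tt.
- apply: derivable_within_continuous => t /itvP tt.
  have t01 : 0 <= t <= 1 by rewrite !tt.
  by have [] := dk t t01.
by rewrite mul0r => /eqP; rewrite subr_eq0 /k scale1r scale0r addr0 => /eqP.
Qed.

(* A complex mean value theorem: the real one applied to Re g and to Re (i g). *)
Lemma hasd0_eq (g : V -> C) (w d : V) :
  (forall t : R, 0 <= t <= 1 -> exists L, hasd g (w + t%:C *: d) L /\ L d = 0) ->
  g (w + d) = g w.
Proof.
move=> H; have e1 := hasd0_Re H.
have : complex.Re (g (w + d) * 'i) = complex.Re (g w * 'i).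
  apply: (@hasd0_Re (fun z => g z * 'i)) => t /H[L [hL L0]].
  eexists; split; first exact: hasdM hL (hasd_cst _ _).
  by rewrite /= L0 !mulr0 addr0.
rewrite !ReiNIm => /oppr_inj e2.
by apply/eqP; rewrite eq_complex e1 e2 !eqxx.
Qed.

End RealLine.

(** * The four-point identity *)

Definition det2 (K : comPzRingType) (u v : K * K) : K := u.1 * v.2 - u.2 * v.1.

Lemma det2_eq0 (K : fieldType) (u v : K * K) : u != 0 -> det2 u v = 0 ->
  exists k, v = (k * u.1, k * u.2).
Proof.
case: u v => u1 u2 [v1 v2]; rewrite xpair_eqE negb_and /det2 /=.
have [-> /=|u10 _] := eqVneq u1 0.
  move=> u20 /eqP; rewrite mul0r sub0r oppr_eq0 mulf_eq0 (negbTE u20) => /eqP ->.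
  by exists (v2 / u2); rewrite mulr0 divfK.
move=> /eqP; rewrite subr_eq0 => /eqP e; exists (v1 / u1); rewrite divfK //.
by congr (_, _); apply: (mulfI u10); rewrite e; field.
Qed.

(** Vanishing expresses, with denominators cleared, that N1 / N2 is a function of x times a function
    of y. *)
Definition fourpt (R : realType) (N1 N2 : C2 R -> R[i]) (x y x' y' : R[i]) : R[i] :=
  N1 (x, y) * N1 (x', y') * (N2 (x, y') * N2 (x', y))
  - N1 (x, y') * N1 (x', y) * (N2 (x, y) * N2 (x', y')).

(** The expression is polynomial in each variable, so the four variables are freed from the infinite
    sequences one at a time. *)
Lemma fourpt_grid (R : realType) (A B p q c m : R[i]) (u v : nat -> R[i]) :
  injective u -> injective v ->
  (forall n k n' k', fourpt (graph_N1 A B p q c m) (graph_N2 A B p q c m)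
     (u n) (v k) (u n') (v k') = 0) ->
  forall x y x' y', fourpt (graph_N1 A B p q c m) (graph_N2 A B p q c m) x y x' y' = 0.
Proof.
move=> uI vI H; rewrite /fourpt /graph_N1 /graph_N2 /graph_num /graph_den /= in H *.
move=> x y x' y'; move: y'; apply: (polyfun_eq0 _ vI); first by polyfun_rules.
move=> k'; move: x'; apply: (polyfun_eq0 _ uI); first by polyfun_rules.
move=> n'; move: y; apply: (polyfun_eq0 _ vI); first by polyfun_rules.
move=> k; move: x; apply: (polyfun_eq0 _ uI); first by polyfun_rules.
by move=> n; exact: H.
Qed.

Section LineDerivative.
Context {K : numFieldType} {V : normedModType K}.

Lemma hasd_unique (f : V -> K) w L M h : hasd f w L -> hasd f w M -> L h = M h.
Proof. by move=> [_ <-] [_ <-]. Qed.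

Lemma hasd_line (g : V -> K) (w d : V) L : hasd g w L ->
  hasd (fun s : K^o => g (s *: d + w)) 0 (fun s => L (s *: d)).
Proof.
move=> hg; have dl : is_diff (0 : K^o) (fun s : K^o => s *: d + w) (fun s => s *: d).
  have := is_diffD (is_diff_scalel (0 : K^o) d) (is_diff_cst w (0 : K^o)).
  by rewrite addr0.
case: dl => dl dE; have := @hasd_comp _ _ _ (fun s : K^o => s *: d + w) g 0 L dl.
by rewrite scale0r add0r dE; exact.
Qed.

End LineDerivative.

(** The ratios M_ij / L_ij = k b_j / a_i form a matrix of rank one; the conclusion is its minor with
    denominators cleared. *)
Lemma cross_ratio_eq (F : idomainType) (k a1 a2 b1 b2 : F)
    (M11 M12 M21 M22 L11 L12 L21 L22 : F) : a1 != 0 -> a2 != 0 ->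
  M11 * a1 = k * L11 * b1 -> M12 * a1 = k * L12 * b2 ->
  M21 * a2 = k * L21 * b1 -> M22 * a2 = k * L22 * b2 ->
  M11 * M22 * (L12 * L21) - M12 * M21 * (L11 * L22) = 0.
Proof.
move=> a10 a20 E11 E12 E21 E22.
apply: (mulIf a10); apply: (mulIf a20); rewrite !mul0r.
transitivity ((M11 * a1) * (M22 * a2) * (L12 * L21)
  - (M12 * a1) * (M21 * a2) * (L11 * L22)); first by ring.
by rewrite E11 E22 E12 E21; ring.
Qed.

(** * The web in a parallelizing chart *)

Section Web.
Local Open Scope complex_scope.
Context {R : realType}.
Local Notation C := R[i].
Context (A B p q c m : C).
Local Notation P := (cubic A B p q c m : C3 R -> C^o).
Context (W : set (C2 R)) (psi : C2 R -> C3 R) (w0 : C2 R) (d1 d2 d3 : C2 R).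
Hypothesis oW : open W.
Hypothesis Ww0 : W w0.
Hypothesis dpsi : forall w, W w -> differentiable psi w.
Hypothesis ipsi : {in W &, injective psi}.
Hypothesis imm : forall w, W w -> forall h : C2 R, 'd psi w h = 0 -> h = 0.
Hypothesis Wweb : forall w, W w -> S_web P (psi w).
Hypothesis d1n : d1 != 0.
Hypothesis d2n : d2 != 0.
Hypothesis d3n : d3 != 0.
Hypothesis e1 : forall w, W w -> x1 ('d psi w d1) = 0.
Hypothesis e2 : forall w, W w -> x2 ('d psi w d2) = 0.
Hypothesis e3 : forall w, W w -> x3 ('d psi w d3) = 0.

Lemma psi_tangent w h : W w -> tangentS P (psi w) ('d psi w h).
Proof.
move=> ww; have hP := hasd_comp (dpsi ww) (hasd_cubic A B p q c m (psi w)).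
have h0 : hasd (fun z => cubic A B p q c m (psi z)) w (fun=> 0).
  apply: near_hasd (hasd_cst w (0 : C)).
  have : \forall z \near w, W z by exact: open_nbhs_nbhs.
  by apply: filterS => z /Wweb /S_webP[].
have := hasd_unique h hP h0 => /= E.
by apply/tangentSE; rewrite Pd_cubic0 Pd_cubic1 Pd_cubic2.
Qed.

Lemma web_neq0 (i j : 'I_3) w (d : C2 R) : W w -> i != j -> d != 0 ->
  coord3 i ('d psi w d) = 0 -> coord3 j ('d psi w d) = 0 -> False.
Proof.
move=> ww ij dn di dj; move/eqP: dn; apply; apply: (imm ww).
by have [_ /(_ i j ij)] := Wweb ww; apply=> //; exact: psi_tangent.
Qed.

(** Proportional directions would give a nonzero vector tangent to two transversal foliations. *)
Lemma web_det (i j : 'I_3) (u v : C2 R) : i != j -> u != 0 -> v != 0 ->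
  (forall w, W w -> coord3 i ('d psi w u) = 0) ->
  (forall w, W w -> coord3 j ('d psi w v) = 0) -> det2 (u : C * C) v != 0.
Proof.
move=> ij un vn ui vj; apply/eqP => /(det2_eq0 un) [k vE].
have {}vE : v = k *: u by rewrite vE.
apply: (web_neq0 Ww0 ij vn); last exact: vj.
rewrite vE linearZ /=; have := ui _ Ww0.
by case: (ord3P i) => ->; rewrite !coord3E /= => H;
  rewrite -[LHS]/(k * _) H mulr0.
Qed.

Lemma web_radius : exists r : R, 0 < r /\
  forall s t : C, `|s| < r%:C -> `|t| < r%:C -> W (w0 + s *: d2 + t *: d1).
Proof.
have /nbhs_ballP[e /= e0 He] : nbhs w0 W by exact: open_nbhs_nbhs.
have eE : (complex.Re e)%:C = e by apply: RRe_real; exact: gtr0_real.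
pose M := 1 + `|d1| + `|d2|.
have M0 : 0 < M by rewrite ltr_wpDr // ltr_wpDr.
have rE : (complex.Re (e / M))%:C = e / M.
  by apply: RRe_real; apply: gtr0_real; exact: divr_gt0.
exists (complex.Re (e / M)); split; first by rewrite -ltcR rE divr_gt0.
rewrite rE => s t hs ht; apply: He; rewrite -ball_normE /=.
rewrite -addrA opprD addrA subrr sub0r normrN.
apply: le_lt_trans (ler_normD _ _) _; rewrite !normrZ.
have lt : e / M * (`|d1| + `|d2|) < e.
  by rewrite mulrAC ltr_pdivrMr // ltr_pM2l // /M -addrA ltrDr ltr01.
apply: le_lt_trans lt; rewrite [X in _ <= _ * X]addrC mulrDr.
by apply: lerD; rewrite ler_wpM2r // ltW.
Qed.

Let n01 : ord0 != inord 1 :> 'I_3.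
Proof. by apply/eqP => /(congr1 val); rewrite /= inordK. Qed.
Let n12 : inord 1 != ord_max :> 'I_3.
Proof. by apply/eqP => /(congr1 val); rewrite /= inordK. Qed.

Context (r : R) (r0 : 0 < r).
(* x is constant along d1 and y along d2, so x depends on s only and y on t only. *)
Let pt (s t : C) : C2 R := w0 + s *: d2 + t *: d1.
Hypothesis Wpt : forall s t : C, `|s| < r%:C -> `|t| < r%:C -> W (pt s t).

Lemma real_scale_lt (t : R) (s : C) : 0 <= t <= 1 -> `|s| < r%:C ->
  `|t%:C * s| < r%:C.
Proof.
move=> /andP[t0 t1] hs; apply: le_lt_trans hs; rewrite normrM.
rewrite -[leRHS]mul1r ler_wpM2r // normc_def /= expr0n addr0 sqrtr_sqr ger0_norm //.
by rewrite lecR.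
Qed.

Lemma pt_x1 s t : `|s| < r%:C -> `|t| < r%:C ->
  x1 (psi (pt s t)) = x1 (psi (pt s 0)).
Proof.
move=> hs ht; have -> : pt s t = pt s 0 + t *: d1 by rewrite /pt scale0r addr0.
apply: (@hasd0_eq _ _ (fun z => x1 (psi z))) => u u01.
have -> : pt s 0 + u%:C *: (t *: d1) = pt s (u%:C * t).
  by rewrite /pt scale0r addr0 scalerA.
have ww := Wpt hs (real_scale_lt u01 ht).
eexists; split; first exact: (hasd_comp (dpsi ww) (hasd_x3 _)).
by rewrite /= linearZ /= -[LHS]/(t * _) e1 // mulr0.
Qed.

Lemma pt_x2 s t : `|s| < r%:C -> `|t| < r%:C ->
  x2 (psi (pt s t)) = x2 (psi (pt 0 t)).
Proof.
move=> hs ht; have -> : pt s t = pt 0 t + s *: d2.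
  by rewrite /pt scale0r addr0 addrAC.
apply: (@hasd0_eq _ _ (fun z => x2 (psi z))) => u u01.
have -> : pt 0 t + u%:C *: (s *: d2) = pt (u%:C * s) t.
  by rewrite /pt scale0r addr0 scalerA addrAC.
have ww := Wpt (real_scale_lt u01 hs) ht.
eexists; split; first exact: (hasd_comp (dpsi ww) (hasd_y3 _)).
by rewrite /= linearZ /= -[LHS]/(s * _) e2 // mulr0.
Qed.

Lemma near_disc (s : C) : `|s| < r%:C -> \forall h \near (0 : C^o), `|h + s| < r%:C.
Proof.
move=> hs; have e0 : 0 < r%:C - `|s| by rewrite subr_gt0.
apply/nbhs_ballP; exists (r%:C - `|s|) => //= h.
rewrite -ball_normE /= sub0r normrN ltrBrDr; apply: le_lt_trans.
exact: ler_normD.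
Qed.

Lemma norm0_lt_radius : `|0 : C| < r%:C.
Proof. by rewrite normr0 -[X in X < _]/(0%:C) ltcR. Qed.

(** Near s, x along the line through [pt s t] and x along the line through [pt s 0], both in
    direction d2, are the same function, so their derivatives agree. *)
Lemma pt_dx1 s t : `|s| < r%:C -> `|t| < r%:C ->
  x1 ('d psi (pt s t) d2) = x1 ('d psi (pt s 0) d2).
Proof.
move=> hs ht; have w1 := Wpt hs ht; have w2 := Wpt hs norm0_lt_radius.
have h1 := hasd_line d2 (hasd_comp (dpsi w1) (hasd_x3 _)).
have h2 := hasd_line d2 (hasd_comp (dpsi w2) (hasd_x3 _)).
have := hasd_unique (1 : C^o) (near_hasd _ h1) h2; rewrite !scale1r; apply.
have := near_disc hs; apply: filterS => h hh /=.
have E z : h *: d2 + pt s z = pt (h + s) z.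
  by rewrite /pt scalerDl !addrA [h *: d2 + w0]addrC.
by rewrite !E; exact: pt_x1.
Qed.

Lemma pt_dx2 s t : `|s| < r%:C -> `|t| < r%:C ->
  x2 ('d psi (pt s t) d1) = x2 ('d psi (pt 0 t) d1).
Proof.
move=> hs ht; have w1 := Wpt hs ht; have w2 := Wpt norm0_lt_radius ht.
have h1 := hasd_line d1 (hasd_comp (dpsi w1) (hasd_y3 _)).
have h2 := hasd_line d1 (hasd_comp (dpsi w2) (hasd_y3 _)).
have := hasd_unique (1 : C^o) (near_hasd _ h1) h2; rewrite !scale1r; apply.
have := near_disc ht; apply: filterS => h hh /=.
have E z : h *: d1 + pt z t = pt z (h + t) by rewrite /pt scalerDl addrCA.
by rewrite !E; exact: pt_x2.
Qed.

Local Notation N1 := (graph_N1 A B p q c m).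
Local Notation N2 := (graph_N2 A B p q c m).

(** Tangency to S gives P_x dx(d2) = - P_z dz(d2) and P_y dy(d1) = - P_z dz(d1). The values dz(d1)
    and dz(d2) are in a constant ratio, because z is constant along d3, a fixed combination of d1
    and d2. *)
Lemma web_ratio : exists k : C, forall s t, `|s| < r%:C -> `|t| < r%:C ->
  N1 (x1 (psi (pt s 0)), x2 (psi (pt 0 t))) * x1 ('d psi (pt s 0) d2)
  = k * N2 (x1 (psi (pt s 0)), x2 (psi (pt 0 t))) * x2 ('d psi (pt 0 t) d1).
Proof.
have w01 : forall w, W w -> coord3 ord0 ('d psi w d1) = 0 by exact: e1.
have w12 w : W w -> coord3 (inord 1) ('d psi w d2) = 0.
  by move=> ww; rewrite coord3_1; exact: e2.
have w23 : forall w, W w -> coord3 ord_max ('d psi w d3) = 0 by exact: e3.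
have D12 := web_det n01 d1n d2n w01 w12.
have D23 := web_det n12 d2n d3n w12 w23.
have D13 : det2 (d1 : C * C) d3 != 0.
  by apply: (web_det _ d1n d3n w01 w23).
exists (det2 (d2 : C * C) d3 / det2 (d1 : C * C) d3) => s t hs ht.
have ww := Wpt hs ht.
(* All quantities are moved from the two axes of the chart to the common point [pt s t]. *)
rewrite -(pt_x1 hs ht) -(pt_x2 hs ht) -(pt_dx1 hs ht) -(pt_dx2 hs ht).
have /tangentSE T1 := psi_tangent d1 ww.
have /tangentSE T2 := psi_tangent d2 ww.
have T3 : det2 (d2 : C * C) d3 * x3 ('d psi (pt s t) d1)
    = det2 (d1 : C * C) d3 * x3 ('d psi (pt s t) d2).
  (* Cramer's identity for three vectors in the plane. *)
  have d3E : det2 (d1 : C * C) d2 *: d3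
      = det2 (d1 : C * C) d3 *: d2 - det2 (d2 : C * C) d3 *: d1.
    case: (d1) (d2) (d3) => u1 u2 [v1 v2] [z1 z2]; rewrite /det2 /=.
    apply/eqP; rewrite xpair_eqE; apply/andP; split; apply/eqP.
      rewrite -[LHS]/(((u1 : C) * v2 - u2 * v1) * (z1 : C)).
      rewrite -[RHS]/(((u1 : C) * z2 - u2 * z1) * (v1 : C) - ((v1 : C) * z2 - v2 * z1) * (u1 : C)).
      by ring.
    rewrite -[LHS]/(((u1 : C) * v2 - u2 * v1) * (z2 : C)).
    rewrite -[RHS]/(((u1 : C) * z2 - u2 * z1) * (v2 : C) - ((v1 : C) * z2 - v2 * z1) * (u2 : C)).
    by ring.
  have := congr1 (fun h => x3 ('d psi (pt s t) h)) d3E.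
  rewrite /= linearB !linearZ /= => E.
  apply/eqP; rewrite eq_sym -subr_eq0; apply/eqP.
  transitivity (det2 (d1 : C * C) d2 * x3 ('d psi (pt s t) d3)).
    by rewrite -mulrN; exact: esym E.
  by rewrite e3 // mulr0.
have /S_webP[P0 _ _] := Wweb ww.
move: T1 T2; rewrite e1 // e2 //.
rewrite Pd_cubic0 Pd_cubic1 Pd_cubic2.
move: P0 T3 D13.
move: (x1 ('d psi (pt s t) d2)) (x2 ('d psi (pt s t) d1)) => a b.
move: (x3 ('d psi (pt s t) d1)) (x3 ('d psi (pt s t) d2)) => a' b'.
move: (det2 (d1 : C * C) d3) (det2 (d2 : C * C) d3) => k1 k2.
case: (psi (pt s t)) => -[x y] z /=.
rewrite -/(graph_den c (x, y)) => P0 T3 k10 T1 T2 D0.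
have zE := cubic_graph_z (v := ((x, y), z)) D0 P0.
rewrite -(graph_P1_den _ _ _ _ _ D0) -(graph_P2_den _ _ _ _ _ D0) /graph_P1 /graph_P2 -zE /=.
move: T1 T2; set p1 := _ + p; set p2 := _ + q => T1 T2.
have b'E : b' = k2 / k1 * a' by rewrite mulrAC T3 mulrC mulKf.
have p2E : p2 * b = - (graph_den c (x, y) * a').
  by apply/eqP; rewrite -addr_eq0 -[X in _ == X]T1; apply/eqP; ring.
have p1E : p1 * a = - (graph_den c (x, y) * b').
  by apply/eqP; rewrite -addr_eq0 -[X in _ == X]T2; apply/eqP; ring.
rewrite mulrAC p1E b'E; transitivity (k2 / k1 * (p2 * b) * graph_den c (x, y)).
  by rewrite p2E; ring.
by ring.
Qed.

Lemma web_fourpt_zero : forall x y x' y', fourpt N1 N2 x y x' y' = 0.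
Proof.
have [k rat] := web_ratio.
(* Infinitely many distinct parameters; the shift by 2 keeps them strictly below r already at n =
   0. *)
pose t n : C := (r / n.+2%:R)%:C.
have ht n : `|t n| < r%:C.
  rewrite /t normc_def /= expr0n addr0 sqrtr_sqr ger0_norm; last first.
    by rewrite divr_ge0 // ltW.
  by rewrite ltcR ltr_pdivrMr // ltr_pMr // ltr1n.
have tI : injective t.
  move=> n k' /complexI /(mulfI (lt0r_neq0 r0)) /invr_inj /eqP.
  by rewrite eqr_nat => /eqP [].
have h0 := norm0_lt_radius.
(* On the web domain P_z is nonzero, so x and y determine z and hence the point of the chart. *)
have psiI w w' : W w -> W w' -> x1 (psi w) = x1 (psi w') ->
    x2 (psi w) = x2 (psi w') -> w = w'.
  move=> ww ww' E1 E2; apply: ipsi; rewrite ?mem_set //.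
  have /S_webP[P0 _ _] := Wweb ww; have /S_webP[P0' _ _] := Wweb ww'.
  rewrite !Pd_cubic2; move: P0 P0' E1 E2.
  case: (psi w) (psi w') => -[x y] z [[x' y'] z'] /= P0 P0' E1 E2 D0' D0.
  have zE := cubic_graph_z (v := ((x, y), z)) D0 P0.
  have zE' := cubic_graph_z (v := ((x', y'), z')) D0' P0'.
  by rewrite /= in zE zE'; rewrite zE zE' E1 E2.
apply: (@fourpt_grid _ _ _ _ _ _ _ (fun n => x1 (psi (pt (t n) 0)))
  (fun n => x2 (psi (pt 0 (t n))))).
- move=> n n' E; apply: tI.
  have E2 := etrans (pt_x2 (ht n) h0) (esym (pt_x2 (ht n') h0)).
  have := psiI _ _ (Wpt (ht n) h0) (Wpt (ht n') h0) E E2.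
  move=> /addIr /addrI /eqP.
  rewrite -subr_eq0 -scalerBl scaler_eq0 (negbTE d2n) orbF subr_eq0.
  by move/eqP.
- move=> n n' E; apply: tI.
  have E1 := etrans (pt_x1 h0 (ht n)) (esym (pt_x1 h0 (ht n'))).
  have := psiI _ _ (Wpt h0 (ht n)) (Wpt h0 (ht n')) E1 E.
  move=> /addrI /eqP.
  rewrite -subr_eq0 -scalerBl scaler_eq0 (negbTE d1n) orbF subr_eq0.
  by move/eqP.
move=> n1 k1 n2 k2; rewrite /fourpt.
have E11 := rat _ _ (ht n1) (ht k1); have E12 := rat _ _ (ht n1) (ht k2).
have E21 := rat _ _ (ht n2) (ht k1); have E22 := rat _ _ (ht n2) (ht k2).
have a_neq0 n : x1 ('d psi (pt (t n) 0) d2) != 0.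
  apply/eqP => E; have ww := Wpt (ht n) h0.
  apply: (web_neq0 ww n01 d2n) => //.
  by rewrite coord3_1; exact: e2.
exact: (cross_ratio_eq (a_neq0 n1) (a_neq0 n2) E11 E12 E21 E22).
Qed.

End Web.

(** * Failure of the four-point identity *)

Section NonParallel.
Local Open Scope complex_scope.
Context {R : realType}.
Local Notation C := R[i].
Context (A B p q c m : C).
Local Notation P := (cubic A B p q c m : C3 R -> C^o).
Local Notation N1 := (graph_N1 A B p q c m).
Local Notation N2 := (graph_N2 A B p q c m).

Lemma parallelizable_fourpt v : web_parallelizable_at P v ->
  forall x y x' y', fourpt N1 N2 x y x' y' = 0.
Proof.
move=> [W [psi [w0 [[oW dpsi ipsi imm [V [oV VE]]] Ww0 _ par]]]].
have Wweb w : W w -> S_web P (psi w).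
  move=> ww; suff [] : (V `&` S_web P) (psi w) by [].
  by rewrite -VE; exists w.
have dir k : exists d : C2 R, d != 0 /\
    forall w, W w -> coord3 k ('d psi w d) = 0.
  (* The vector (b, -a) spans the kernel of a du + b dv. *)
  have [a [b [ab H]]] := par k; exists (b, - a); split.
    apply/eqP => -[b0 /eqP]; rewrite oppr_eq0 => /eqP a0.
    by move: ab; rewrite b0 a0 eqxx; case.
  move=> w ww; have {H} := H w ww.
  have hk : hasd (fun z => coord3 k (psi z)) w (fun h => coord3 k ('d psi w h)).
    case: (ord3P k) => ->.
    - exact: (hasd_comp (dpsi w ww) (hasd_x3 _)).
    - rewrite (_ : coord3 (inord 1) = fun u : C3 R => x2 u); last first.
        by apply/funext => u; rewrite coord3_1.
      exact: (hasd_comp (dpsi w ww) (hasd_y3 _)).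
    - exact: (hasd_comp (dpsi w ww) (hasd_z3 _)).
  rewrite !(hasd_derive _ hk) !e2E => E.
  have -> : (b, - a) = b *: ((1, 0) : C2 R) - a *: ((0, 1) : C2 R).
    apply/eqP; rewrite xpair_eqE; apply/andP; split; apply/eqP.
      by rewrite -[RHS]/(b * 1 - a * 0); ring.
    by rewrite -[RHS]/(b * 0 - a * 1); ring.
  rewrite linearB 2!linearZ.
  have cB (a' b' : C) (X Y : C3 R) :
      coord3 k (b' *: X - a' *: Y) = b' * coord3 k X - a' * coord3 k Y.
    by case: (ord3P k) => ->; rewrite !coord3E.
  by rewrite [LHS]cB E subrr.
have [d1 [d1n e1]] := dir ord0.
have [d2 [d2n e2]] := dir (inord 1).
have [d3 [d3n e3]] := dir ord_max.
have {}e2 w : W w -> x2 ('d psi w d2) = 0.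
  by move=> ww; rewrite -coord3_1; exact: e2.
have [r [r0 Wr]] := web_radius d1 d2 oW Ww0.
exact: (web_fourpt_zero oW Ww0 dpsi ipsi imm Wweb d1n d2n d3n e1 e2 e3 r0 Wr).
Qed.

Lemma quadratic_neq0 (a b d : C) : a != 0 -> exists x, a * x ^+ 2 + b * x + d != 0.
Proof.
move=> a0; apply: contrapT => /forallNP /= H; case/eqP: a0.
have z x : a * x ^+ 2 + b * x + d = 0 by have /negP := H x; rewrite negbK => /eqP.
have : 2 * a = 0.
  transitivity ((a * 1 ^+ 2 + b * 1 + d) + (a * (-1) ^+ 2 + b * (-1) + d)
    - 2 * (a * 0 ^+ 2 + b * 0 + d)); first by ring.
  by rewrite !z; ring.
by move/eqP; rewrite mulf_eq0 pnatr_eq0 => /eqP.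
Qed.

(* The coefficient of x^5 in the four-point identity at y = 1, y' = 0. *)
Lemma not_parallelizable_c v : A != 0 -> c != 0 -> ~ web_parallelizable_at P v.
Proof.
move=> A0 c0 /parallelizable_fourpt H.
have [a a0] : exists x, 2 * A * x + p != 0.
  apply: contrapT => /forallNP /= L; case/eqP: A0.
  have z x : 2 * A * x + p = 0 by have /negP := L x; rewrite negbK => /eqP.
  have : 2 * A = 0.
    by transitivity ((2 * A * 1 + p) - (2 * A * 0 + p)); [ring|rewrite !z; ring].
  by move/eqP; rewrite mulf_eq0 pnatr_eq0 => /eqP.
have [b b0] : exists x, N2 (x, 1) != 0.
  apply: contrapT => /forallNP /= L; case/eqP: A0.
  have z x : N2 (x, 1) = 0 by have /negP := L x; rewrite negbK => /eqP.
  have : 6 * A = 0.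
    transitivity (- (N2 (3, 1) - 3 * N2 (2, 1) + 3 * N2 (1, 1) - N2 (0, 1))).
      by rewrite /graph_N2 /graph_num /graph_den /=; ring.
    by rewrite !z; ring.
  by move/eqP; rewrite mulf_eq0 pnatr_eq0 => /eqP.
(* Since N1(x', 0) = c (2 A x' + p), this choice makes N1(x', 0) and N2(x', 1) both nonzero. *)
have [x' [l0 N20]] : exists x, 2 * A * x + p != 0 /\ N2 (x, 1) != 0.
  by apply: (@polyfun_neq0M _ (fun x => 2 * A * x + p) (fun x => N2 (x, 1)) a b) => //;
    rewrite /graph_N2 /graph_num /graph_den /=; polyfun_rules.
pose F x := fourpt N1 N2 x 1 x' 0.
have F0 x : F x = 0 by exact: H.
(* F has degree at most 5, and 120 = 5!: the fifth difference isolates the coefficient - A^2 N1(x',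
   0) N2(x', 1) of x^5. *)
have : 120 * (A ^+ 2 * (c * (2 * A * x' + p)) * N2 (x', 1)) = 0.
  transitivity (- (F 5 - 5 * F 4 + 10 * F 3 - 10 * F 2 + 5 * F 1 - F 0)).
    rewrite /F /fourpt.
    have -> : c * (2 * A * x' + p) = N1 (x', 0) by rewrite /graph_N1 /graph_den /=; ring.
    move: (N1 (x', 0)) (N1 (x', 1)) (N2 (x', 1)) (N2 (x', 0)) => K1 K2 K3 K4.
    by rewrite /graph_N1 /graph_N2 /graph_num /graph_den /=; ring.
  by rewrite !F0; ring.
move=> /eqP; rewrite !mulf_eq0 pnatr_eq0 (negbTE c0) (negbTE l0) (negbTE N20).
by rewrite ?expf_eq0 (negbTE A0).
Qed.

(* For c = 0, N1 = y f1 and N2 = x f2; at a zero of f1 that is not a zero of f2 the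
   identity would force f1 to vanish on a coordinate line. *)
Lemma not_parallelizable_c0 v x0 y0 : A != 0 -> B != 0 -> c = 0 ->
  A * x0 ^+ 2 - (B * y0 ^+ 2 + q * y0 + m) = 0 ->
  B * y0 ^+ 2 - (A * x0 ^+ 2 + p * x0 + m) != 0 ->
  ~ web_parallelizable_at P v.
Proof.
move=> A0 B0 c0 n1 n2 /parallelizable_fourpt H.
pose f1 (x y : C) := A * x ^+ 2 - (B * y ^+ 2 + q * y + m).
pose f2 (x y : C) := B * y ^+ 2 - (A * x ^+ 2 + p * x + m).
(* On positive integers the common factor x y x' y' of the identity can be cancelled. *)
pose u n : C := n.+1%:R.
have uI : injective u by move=> n k /eqP; rewrite eqr_nat => /eqP [].
have u0 n : u n != 0 by rewrite pnatr_eq0.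
have F : forall x y x' y', f1 x y * f1 x' y' * (f2 x y' * f2 x' y)
    - f1 x y' * f1 x' y * (f2 x y * f2 x' y') = 0.
  rewrite /f1 /f2.
  move=> x y x' y'; move: y'; apply: (polyfun_eq0 _ uI); first by polyfun_rules.
  move=> k'; move: x'; apply: (polyfun_eq0 _ uI); first by polyfun_rules.
  move=> n'; move: y; apply: (polyfun_eq0 _ uI); first by polyfun_rules.
  move=> k; move: x; apply: (polyfun_eq0 _ uI); first by polyfun_rules.
  move=> n; rewrite -!/(f1 _ _) -!/(f2 _ _).
  have := H (u n) (u k) (u n') (u k'); rewrite /fourpt.
  have E1 x y : N1 (x, y) = y * f1 x y.
    by rewrite /graph_N1 /graph_num /graph_den /f1 c0 /=; ring.
  have E2 x y : N2 (x, y) = x * f2 x y.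
    by rewrite /graph_N2 /graph_num /graph_den /f2 c0 /=; ring.
  rewrite !E1 !E2; move: (u0 n) (u0 k) (u0 n') (u0 k').
  move: (u n) (u k) (u n') (u k') => x y x' y' xn yn xn' yn' E.
  apply: (mulfI xn); apply: (mulfI yn); apply: (mulfI xn'); apply: (mulfI yn').
  by rewrite !mulr0 -[RHS]E; ring.
(* At (x0, y0) the first product vanishes; y' and x' are chosen so that, in the second, every factor
   other than f2(x0, y0) is nonzero. *)
have [y' y'0] : exists y', f1 x0 y' != 0.
  have [|y' y'0] := @quadratic_neq0 (- B) (- q) (A * x0 ^+ 2 - m).
    by rewrite oppr_eq0.
  exists y'; apply: contraNneq y'0; rewrite /f1 => E.
  by apply/eqP; rewrite -[RHS]E; ring.
have [x1 x10] : exists x, f1 x y0 != 0.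
  have [x1 x10] := @quadratic_neq0 A 0 (- (B * y0 ^+ 2 + q * y0 + m)) A0.
  exists x1; apply: contraNneq x10; rewrite /f1 => E.
  by apply/eqP; rewrite -[RHS]E; ring.
have [x2 x20] : exists x, f2 x y' != 0.
  have [|x2 x20] := @quadratic_neq0 (- A) (- p) (B * y' ^+ 2 - m).
    by rewrite oppr_eq0.
  exists x2; apply: contraNneq x20; rewrite /f2 => E.
  by apply/eqP; rewrite -[RHS]E; ring.
have [x' [xa xb]] : exists x, f1 x y0 != 0 /\ f2 x y' != 0.
  by apply: (@polyfun_neq0M _ (f1^~ y0) (f2^~ y') x1 x2) => //;
    rewrite /f1 /f2; polyfun_rules.
have := F x0 y0 x' y'; rewrite [f1 x0 y0]n1 !mul0r sub0r => /eqP.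
rewrite oppr_eq0 !mulf_eq0 (negbTE y'0) (negbTE xa) (negbTE xb) /=.
by rewrite orbF (negbTE n2).
Qed.

End NonParallel.

(** * The complex exponential and Riccati flows *)

Section ComplexExp.
Local Open Scope complex_scope.
Context {R : realType}.
Local Notation C := R[i].
Local Notation Re := complex.Re.
Local Notation Im := complex.Im.

Lemma normc_ge_Im (z : C) : `|Im z|%:C <= `|z|.
Proof.
have := normc_ge_Re (z * 'i); rewrite ReiNIm normrN normrM.
suff -> : `|'i : C| = 1 by rewrite mulr1.
by rewrite normc_def /= expr0n add0r expr1n sqrtr1.
Qed.

Lemma normc_le_ReIm (z : C) : `|z| <= (`|Re z| + `|Im z|)%:C.
Proof.
case: z => a b /=; rewrite normc_def /= lecR.
rewrite -[leRHS]ger0_norm ?addr_ge0 // -sqrtr_sqr ler_wsqrtr //.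
rewrite sqrrD !real_normK ?num_real // -addrA lerD2l lerDr.
by rewrite mulrn_wge0 // mulr_ge0.
Qed.

Lemma continuous_Re : continuous (@complex.Re R : C^o -> R).
Proof.
move=> z V /nbhs_ballP[e /= e0 HV].
have e0C : 0 < e%:C by rewrite ltcR.
apply/nbhs_ballP; exists e%:C => //= w; rewrite -ball_normE /= => zw.
apply: HV; rewrite -ball_normE /= -ltcR; apply: le_lt_trans zw.
have -> : Re z - Re w = Re (z - w) by case: (z) (w) => ? ? [].
exact: normc_ge_Re.
Qed.

Lemma continuous_Im : continuous (@complex.Im R : C^o -> R).
Proof.
move=> z V /nbhs_ballP[e /= e0 HV].
have e0C : 0 < e%:C by rewrite ltcR.
apply/nbhs_ballP; exists e%:C => //= w; rewrite -ball_normE /= => zw.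
apply: HV; rewrite -ball_normE /= -ltcR; apply: le_lt_trans zw.
have -> : Im z - Im w = Im (z - w) by case: (z) (w) => ? ? [].
exact: normc_ge_Im.
Qed.

Definition expc (z : C) : C :=
  (expR (Re z) * cos (Im z)) +i* (expR (Re z) * sin (Im z)).

Lemma expc0 : expc 0 = 1.
Proof. by rewrite /expc /= expR0 cos0 sin0 mulr1 mulr0. Qed.

Lemma expcD z w : expc (z + w) = expc z * expc w.
Proof.
case: z w => a b [a' b']; rewrite /expc /= expRD cosD sinD.
by apply/eqP; rewrite eq_complex /=; apply/andP; split; apply/eqP; ring.
Qed.

Lemma expc_neq0 z : expc z != 0.
Proof.
apply/eqP => E; have := expcD z (- z); rewrite subrr expc0 E mul0r => /eqP.
by rewrite oner_eq0.
Qed.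

Lemma derive_linear_bound (f : R -> R) (d : R) : is_derive (0 : R) 1 f d ->
  forall e : R, 0 < e -> exists2 r : R, 0 < r &
    forall h, `|h| < r -> `|f h - f 0 - d * h| <= e * `|h|.
Proof.
move=> [df dE] e e0.
have cv : h^-1 *: (f (h *: 1 + 0) - f 0) @[h --> (0 : R)^'] --> d.
  by rewrite -dE; exact: df.
move/cvgrPdist_le: cv => /(_ e e0) /nbhs_ballP [r /= r0 H]; exists r => // h hr.
have [->|h0] := eqVneq h 0; first by rewrite subrr mulr0 subr0 normr0 mulr0.
have := H h; rewrite -ball_normE /= sub0r normrN => /(_ hr h0).
rewrite -[h *: 1]/(h * 1) mulr1 addr0 -[_ *: _]/(_ * _) => Hh.
have -> : f h - f 0 - d * h = - ((d - h^-1 * (f h - f 0)) * h) by field.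
by rewrite normrN normrM ler_wpM2r.
Qed.

(** Complex differentiability at 0 is assembled from the real expansions of exp, cos and sin at
    0. *)
Lemma expc_linear_bound (e : R) : 0 < e -> exists2 r : R, 0 < r &
  forall h : C, `|h| < r%:C -> `|expc h - 1 - h| <= e%:C * `|h|.
Proof.
move=> e0.
(* The error estimates add up to at most 8 e' (|Re h| + |Im h|), and |Re h| + |Im h| <= 2 |h|,
   whence 16. The cap at 1 bounds exp(Re h) by 3. *)
pose e' := Num.min (e / 16) 1.
have e'0 : 0 < e' by rewrite lt_min ltr01 andbT divr_gt0.
have e'1 : e' <= 1 by rewrite ge_min lexx orbT.
have e'8 : 16 * e' <= e.
  by rewrite mulrC -ler_pdivlMr // ge_min lexx.
have [r1 r10 H1] := derive_linear_bound (is_derive_expR (0 : R)) e'0.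
have [r2 r20 H2] := derive_linear_bound (is_derive_cos (0 : R)) e'0.
have [r3 r30 H3] := derive_linear_bound (is_derive_sin (0 : R)) e'0.
exists (Num.min (Num.min r1 r2) (Num.min r3 (e' / 2))).
  by rewrite !lt_min r10 r20 r30 divr_gt0.
move=> h hr.
have hRe : `|Re h| < Num.min (Num.min r1 r2) (Num.min r3 (e' / 2)).
  by rewrite -ltcR; apply: le_lt_trans hr; exact: normc_ge_Re.
have hIm : `|Im h| < Num.min (Num.min r1 r2) (Num.min r3 (e' / 2)).
  by rewrite -ltcR; apply: le_lt_trans hr; exact: normc_ge_Im.
move: hRe hIm; rewrite !lt_min => /andP[/andP[a1 a2] /andP[a3 a4]].
move=> /andP[/andP[b1 b2] /andP[b3 b4]].
have HE := H1 _ a1; have Hc := H2 _ b2; have Hs := H3 _ b3.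
have hn1 := normc_ge_Re h; have hn2 := normc_ge_Im h.
apply: (le_trans (normc_le_ReIm _)).
apply: (@le_trans _ _ (e%:C * ((`|Re h| + `|Im h|) / 2)%:C)); last first.
  apply: ler_wpM2l; first by rewrite ler0c ltW.
  have hE : (complex.Re `|h|)%:C = `|h| by apply: RRe_real; exact: normr_real.
  move: hn1 hn2; rewrite -hE !lecR => *; lra.
rewrite -[e%:C * _]rmorphM /= lecR.
case: h hr a1 a2 a3 a4 b1 b2 b3 b4 hn1 hn2 HE Hc Hs => a b /= _ _ _ _ a4 _ _ _ b4 _ _.
rewrite expR0 cos0 sin0 !mul1r oppr0 !mul0r !subr0.
set E := expR a; set c := cos b; set s := sin b => HE Hc; rewrite !addr0 => Hs.
(* Each part is split so that every term contains the error of one expansion, or the product of the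
   small E - 1 with b. *)
have -> : E * c - 1 - a = E * (c - 1) + (E - 1 - a) by ring.
have -> : E * s - b = E * (s - b) + (E - 1) * b by ring.
have E1 : `|E - 1| <= 2 * e'.
  have -> : E - 1 = (E - 1 - a) + a by ring.
  apply: (le_trans (ler_normD _ _)); nra.
have E2 : `|E| <= 3.
  have -> : E = (E - 1) + 1 by ring.
  apply: (le_trans (ler_normD _ _)); rewrite normr1; lra.
have Hre : `|E * (c - 1) + (E - 1 - a)| <= 3 * e' * `|b| + e' * `|a|.
  apply: (le_trans (ler_normD _ _)); rewrite normrM; apply: lerD => //.
  by rewrite -mulrA; apply: ler_pM.
have Him : `|E * (s - b) + (E - 1) * b| <= 3 * e' * `|b| + 2 * e' * `|b|.
  apply: (le_trans (ler_normD _ _)); rewrite !normrM; apply: lerD => //.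
    by rewrite -mulrA; apply: ler_pM.
  by apply: ler_wpM2r.
have a0 := normr_ge0 a; have b0 := normr_ge0 b.
nra.
Qed.

(** The addition law reduces the difference quotient at z to the expansion at 0. *)
Lemma hasd_expc (z : C) : hasd (expc : C^o -> C) z (fun h => expc z * h).
Proof.
have cv : (fun h : C => h^-1 *: ((expc (h *: (1 : C^o) + z) : C^o) - expc z))
    @ (0 : C^o)^' --> (expc z : C^o).
  apply/cvgrPdist_le => e e0.
  have eE : (Re e)%:C = e by apply: RRe_real; exact: gtr0_real.
  have n0 : 0 < `|expc z| by rewrite normr_gt0 expc_neq0.
  have nE : (Re `|expc z|)%:C = `|expc z| by apply: RRe_real; exact: normr_real.
  have k0 : 0 < Re e / Re `|expc z|.
    by rewrite divr_gt0 // -ltcR ?eE ?nE.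
  have [r r0 H] := expc_linear_bound k0.
  have r0C : 0 < r%:C by rewrite ltcR.
  apply/nbhs_ballP; exists r%:C => //= h.
  rewrite -ball_normE /= sub0r normrN => hr h0.
  have := H h hr; rewrite rmorphM /= fmorphV /= eE nE => Hh.
  rewrite -[h *: _]/(h * 1) mulr1 expcD -[_ *: _]/(_ * _).
  have -> : expc z - h^-1 * (expc h * expc z - expc z)
      = - (expc z / h * (expc h - 1 - h)) by field.
  rewrite normrN normrM normf_div.
  have kh0 : 0 <= `|expc z| / `|h| by rewrite divr_ge0.
  apply: le_trans (ler_wpM2l kh0 Hh) _.
  have hn : `|h| != 0 by rewrite normr_eq0.
  rewrite le_eqVlt; apply/orP; left; apply/eqP; field.
  by rewrite hn lt0r_neq0.
have dv : derivable (expc : C^o -> C^o) z 1.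
  by apply/cvg_ex; exists (expc z); exact: cv.
have df : differentiable (expc : C^o -> C^o) (z : C^o) by exact/derivable1_diffP.
split=> // h; have -> : h = h *: (1 : C^o) by rewrite -[RHS]/(h * 1) mulr1.
rewrite linearZ /= -deriveE //.
have -> : derive (expc : C^o -> C^o) z 1 = expc z by exact: cvg_lim cv.
by rewrite -[LHS]/(h * _) -[_ *: _ in RHS]/(h * 1); ring.
Qed.

(* The principal logarithm, meaningful on the right half-plane only. *)
Definition logc (w : C) : C :=
  (ln (Re w * Num.sqrt (1 + (Im w / Re w) ^+ 2))) +i* (atan (Im w / Re w)).

Lemma logcK (w : C) : 0 < Re w -> expc (logc w) = w.
Proof.
case: w => a b /= a0; rewrite /expc /logc /=.
have s0 : 0 < Num.sqrt (1 + (b / a) ^+ 2).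
  by rewrite sqrtr_gt0 ltr_wpDr // sqr_ge0.
have st : sin (atan (b / a)) = b / a * cos (atan (b / a)).
  rewrite -{2}[b / a]atanK /tan divfK // lt0r_neq0 //.
  by rewrite cos_gt0_pihalf // atan_gtNpi2 atan_ltpi2.
rewrite lnK ?posrE ?mulr_gt0 // st cos_atan.
have an := lt0r_neq0 a0; have sn := lt0r_neq0 s0.
by apply/eqP; rewrite eq_complex /=; apply/andP; split; apply/eqP; field;
  rewrite ?an ?sn.
Qed.

Lemma Im_logc (w : C) : `|Im (logc w)| < pi / 2.
Proof. by rewrite ltr_norml /= atan_gtNpi2 atan_ltpi2. Qed.

Lemma Re_expc_gt0 (z : C) : `|Im z| < pi / 2 -> 0 < Re (expc z).
Proof.
rewrite ltr_norml => /andP[z1 z2].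
by rewrite /= mulr_gt0 ?expR_gt0 // cos_gt0_pihalf // z1.
Qed.

Lemma expcK (z : C) : `|Im z| < pi / 2 -> logc (expc z) = z.
Proof.
move=> hz; have := Re_expc_gt0 hz; move: hz.
case: z => a b /=; rewrite ltr_norml => /andP[b1 b2] pos.
have c0 : 0 < cos b by rewrite cos_gt0_pihalf // b1.
have E0 := expR_gt0 a; have cn := lt0r_neq0 c0; have En := lt0r_neq0 E0.
rewrite /logc /=.
have -> : expR a * sin b / (expR a * cos b) = tan b.
  by rewrite /tan; field; rewrite cn En.
rewrite tanK ?in_itv /= ?b1 //.
have -> : 1 + tan b ^+ 2 = (cos b) ^- 2.
  have e := cos2Dsin2 b; rewrite /tan.
  transitivity ((cos b ^+ 2 + sin b ^+ 2) / cos b ^+ 2); first by field.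
  by rewrite e mul1r.
rewrite -exprVn sqrtr_sqr ger0_norm ?invr_ge0 ?ltW // -mulrA divff // mulr1.
by rewrite expRK.
Qed.

End ComplexExp.

(** * Flows of quadratic fields on the line *)

Section Riccati.
Local Open Scope complex_scope.
Context {R : realType}.
Local Notation C := R[i].
Local Notation Re := complex.Re.
Local Notation Im := complex.Im.

Lemma quadratic_roots (a b d : C) : a != 0 -> exists r1 r2 : C,
  forall x, a * x ^+ 2 + b * x + d = a * (x - r1) * (x - r2).
Proof.
move=> a0; have := sqr_sqrtc (b ^+ 2 - 4 * a * d); move: (sqrtc _) => s sE.
exists ((- b + s) / (2 * a)), ((- b - s) / (2 * a)) => x.
transitivity (a * x ^+ 2 + b * x + (b ^+ 2 - s ^+ 2) / (4 * a)).
  by rewrite sE; field.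
by field.
Qed.

(** A solution of f' = q(f) through x0 that avoids the zeros of q. Injectivity and open image are
    recorded because two such flows will serve as the coordinates of a chart. *)
Definition riccati_flow (q : C -> C) (x0 : C) (U : set C^o) (f : C^o -> C) : Prop :=
  [/\ open U, U 0, f 0 = x0,
      forall u, U u -> hasd f u (fun h => q (f u) * h) /\ q (f u) != 0 &
      {in U &, injective f} /\ open (f @` U : set C^o)].

(** For a double root r, the quantity 1 / (x - r) moves with constant velocity - a. *)
Lemma riccati_double (a r x0 : C) : a != 0 -> a * (x0 - r) * (x0 - r) != 0 ->
  exists U f, riccati_flow (fun x => a * (x - r) * (x - r)) x0 U f.
Proof.
move=> a0; rewrite !mulf_eq0 !negb_or => /andP[/andP[_ n0] _].
pose k := (x0 - r)^-1.
have k0 : k != 0 by rewrite invr_eq0.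
exists [set u : C^o | k - a * (u : C) != 0], (fun u : C^o => r + (k - a * (u : C))^-1).
have hd (u : C^o) : hasd (fun u : C^o => k - a * (u : C)) u (fun h => - a * (h : C)).
  by hasd_auto; ring.
split.
- exact: hasd_open_neq0 hd.
- by rewrite /= mulr0 subr0.
- by rewrite mulr0 subr0 invrK addrC subrK.
- move=> u /= un; split.
    have hu := hd u; hasd_auto => //.
    by field.
  by rewrite addrC addKr !mulf_neq0 ?invr_eq0.
split.
  move=> u u'; rewrite !inE /= => un un' /addrI /invr_inj /addrI /oppr_inj.
  exact: mulfI.
have -> : (fun u : C^o => r + (k - a * (u : C))^-1) @` [set u : C^o | k - a * (u : C) != 0]
    = [set x : C^o | (x : C) - r != 0].
  apply/seteqP; split => [_ [u /= un <-]|x /= xn].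
    by rewrite addrC addKr invr_eq0.
  exists ((k - ((x : C) - r)^-1) / a) => /=.
    by rewrite mulrC divfK // opprB addrCA subrr addr0 invr_eq0.
  by rewrite mulrC divfK // opprB addrCA subrr addr0 invrK addrC subrK.
have hx (x : C^o) : hasd (fun x : C^o => (x : C) - r) x (fun h => h).
  by hasd_auto; ring.
exact: hasd_open_neq0 hx.
Qed.

Lemma riccati_simple (a r1 r2 x0 : C) : a != 0 -> r1 != r2 ->
  a * (x0 - r1) * (x0 - r2) != 0 ->
  exists U f, riccati_flow (fun x => a * (x - r1) * (x - r2)) x0 U f.
Proof.
move=> a0 r12; rewrite !mulf_eq0 !negb_or => /andP[/andP[_ n1] n2].
pose k := (x0 - r1) / (x0 - r2).
have k0 : k != 0 by rewrite mulf_neq0 ?invr_eq0.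
pose d := a * (r1 - r2).
have rn : r1 - r2 != 0 by rewrite subr_eq0.
have d0 : d != 0 by rewrite mulf_neq0.
(* (x - r1) / (x - r2) grows exponentially along the flow. *)
pose E (u : C^o) : C := expc (d * (u : C)).
have hE (u : C^o) : hasd E u (fun h => d * E u * (h : C)).
  have hl : hasd (fun u : C^o => d * (u : C)) u (fun h => d * (h : C)).
    by hasd_auto; ring.
  have := hasd_comp (F := fun u : C^o => (d * (u : C)) : C^o) hl.1 (hasd_expc _).
  by move=> /hasd_eq; apply=> h; rewrite hl.2 mulrCA mulrA.
have hN (u : C^o) : hasd (fun u : C^o => 1 - k * E u) u (fun h => - k * d * E u * (h : C)).
  by have hu := hE u; hasd_auto; ring.
have E0 u : E u != 0 by exact: expc_neq0.
have E00 : E 0 = 1 by rewrite /E mulr0 expc0.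
have EK u : `|Im (d * (u : C))| < pi / 2 -> logc (E u) = d * (u : C).
  exact: expcK.
have ERe u : `|Im (d * (u : C))| < pi / 2 -> 0 < Re (E u).
  exact: Re_expc_gt0.
have lE w : 0 < Re w -> E (logc w / d) = w.
  by move=> w0; rewrite /E mulrC divfK // logcK.
have dE : d = a * (r1 - r2) by [].
have kE : 1 - k = (r1 - r2) / (x0 - r2) by rewrite /k; field.
have kE' : k = (x0 - r1) / (x0 - r2) by [].
clearbody E k d.
pose f (u : C^o) : C := (r1 - r2 * k * E u) / (1 - k * E u).
(* The strip sends [E] into the right half-plane, where [logc] inverts [expc]; the second condition
   removes the poles of f. *)
pose U := [set u : C^o | `|Im (d * (u : C))| < pi / 2] `&` [set u : C^o | 1 - k * E u != 0].
have f1 u : 1 - k * E u != 0 -> f u - r1 = k * E u * (r1 - r2) / (1 - k * E u).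
  by move=> un; rewrite /f; field.
have f2 u : 1 - k * E u != 0 -> f u - r2 = (r1 - r2) / (1 - k * E u).
  by move=> un; rewrite /f; field.
have fE u : 1 - k * E u != 0 -> (f u - r1) / (f u - r2) = k * E u.
  move=> un; rewrite f1 // f2 //; field; rewrite rn un //.
have oU : open U.
  apply: openI; last exact: hasd_open_neq0 hN.
  apply: (@open_comp _ _ (fun u : C^o => Im (d * (u : C))) [set t : R | `|t| < pi / 2]).
    move=> u _.
    apply: (@continuous_comp _ _ _ (fun u : C^o => (d * (u : C)) : C^o) (@complex.Im R)).
      have hl : hasd (fun u : C^o => d * (u : C)) u (fun h => d * (h : C)).
        by hasd_auto; ring.
      by apply: differentiable_continuous; case: hl.
    exact: continuous_Im.
  have -> : [set t : R | `|t| < pi / 2] = ball (0 : R) (pi / 2).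
    by apply/seteqP; split => t /=; rewrite -ball_normE /= sub0r normrN.
  exact: ball_open.
exists U, f; split; first exact: oU.
- split=> /=; first by rewrite mulr0 /= normr0 divr_gt0 ?pi_gt0.
  by rewrite E00 mulr1 kE mulf_neq0 ?invr_eq0.
- rewrite /f E00 !mulr1 kE kE'; field.
  by rewrite rn n2.
- move=> u [/= _ un]; have En := E0 u; split; last first.
    by rewrite f1 // f2 // !mulf_neq0 ?invr_eq0.
  have hu := hE u; have hu' := hN u; rewrite f1 // f2 // /f; hasd_auto => //.
  by rewrite dE; field.
split.
  move=> u u'; rewrite !inE => -[/= u1 u2] [/= v1 v2] ff.
  have : k * E u = k * E u' by rewrite -(fE u u2) -(fE u' v2) ff.
  move=> /(mulfI k0) /(congr1 (@logc R)); rewrite (EK u u1) (EK u' v1).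
  exact: mulfI.
(* The Moebius map [g] recovers [E u] from [f u], which describes the image of f by open
   conditions. *)
pose g (x : C^o) : C := ((x : C) - r1) / (k * ((x : C) - r2)).
have -> : f @` U = [set x : C^o | (x : C) - r2 != 0] `&` [set x : C^o | 0 < Re (g x)].
  apply/seteqP; split => [_ [u [/= u1 u2] <-]|x [/= x1 x2]].
    split=> /=; first by rewrite f2 // mulf_neq0 ?invr_eq0.
    have -> : g (f u) = E u.
      have fn : f u - r2 != 0 by rewrite f2 // mulf_neq0 ?invr_eq0.
      transitivity ((f u - r1) / (f u - r2) / k).
        by rewrite /g; field; rewrite k0 fn.
      by rewrite fE // mulrC mulKf.
    exact: ERe.
  have lE2 := lE _ x2.
  have un : 1 - k * g x = (r1 - r2) / ((x : C) - r2) by rewrite /g; field; rewrite x1 k0.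
  have un0 : 1 - k * g x != 0 by rewrite un mulf_neq0 ?invr_eq0.
  exists (logc (g x) / d).
    split=> /=; last by rewrite lE2.
    by rewrite mulrC divfK // Im_logc.
  by rewrite /f lE2 un /g; field; rewrite ?x1 ?k0 ?rn.
have hx (x : C^o) : hasd (fun x : C^o => (x : C) - r2) x (fun h => h).
  by hasd_auto; ring.
rewrite openE => x [/= xn xg].
apply: filterI; first by apply: open_nbhs_nbhs; split=> //; exact: hasd_open_neq0 hx.
have [L hL] : exists L, hasd g x L.
  by eexists; rewrite /g; hasd_rules; rewrite mulf_neq0.
have cg : {for x, continuous (fun x => Re (g x))}.
  apply: (@continuous_comp _ _ _ (g : C^o -> C^o) (@complex.Re R)).
    by apply: differentiable_continuous; case: hL.
  exact: continuous_Re.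
exact: (cg _ (lt_nbhsr xg)).
Qed.

Lemma riccati (a b d x0 : C) : a != 0 -> a * x0 ^+ 2 + b * x0 + d != 0 ->
  exists U f, riccati_flow (fun x => a * x ^+ 2 + b * x + d) x0 U f.
Proof.
move=> a0; have [r1 [r2 rE]] := quadratic_roots b d a0.
have -> : (fun x => a * x ^+ 2 + b * x + d) = (fun x => a * (x - r1) * (x - r2)).
  by apply/funext.
rewrite rE; have [->|r12] := eqVneq r1 r2; first exact: riccati_double.
exact: riccati_simple.
Qed.

End Riccati.

(** * Parallelizing charts in the exceptional families *)

Section Parallel.
Context {R : realType}.
Local Notation C := R[i].
Context (p q c m : C).
Hypothesis p0 : p != 0.
Hypothesis q0 : q != 0.
Local Notation P := (cubic 0 0 p q c m : C3 R -> C^o).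
Local Notation N1 := (graph_N1 0 0 p q c m).
Local Notation N2 := (graph_N2 0 0 p q c m).
Local Notation q1 := (fun x : C => p * x ^+ 2 + m * x + (- (q * c))).
Local Notation q2 := (fun y : C => q * y ^+ 2 + m * y + (- (p * c))).

(** Here N1 = - q2(y) and N2 = - q1(x), so besides P_z != 0 transversality means that neither
    quadratic field is stationary. *)
Lemma S_web_flat v : S_web P v <->
  [/\ P v = 0, graph_den c v.1 != 0, q1 (x1 v) != 0 & q2 (x2 v) != 0].
Proof.
have aux1 (a b d : C) : a * b = - d -> d != 0 -> a != 0.
  by move=> E; apply: contra_neq => a0; apply: oppr_inj; rewrite -E a0 mul0r oppr0.
have aux2 (a b d : C) : a * b = - d -> a != 0 -> b != 0 -> d != 0.
  by move=> E a0 b0; rewrite -oppr_eq0 -E mulf_neq0.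
have N1E (w : C2 R) : N1 w = - q2 (wy w) by rewrite /graph_N1 /graph_num /graph_den; ring.
have N2E (w : C2 R) : N2 w = - q1 (wx w) by rewrite /graph_N2 /graph_num /graph_den; ring.
have PE : P v = 0 -> graph_den c v.1 != 0 -> Pd P ord0 v * graph_den c v.1 = - q2 (x2 v) /\
    Pd P (inord 1) v * graph_den c v.1 = - q1 (x1 v).
  move=> P0 D0; have zE := cubic_graph_z D0 P0.
  by rewrite Pd_cubic0 Pd_cubic1 -N1E -N2E -(graph_P1_den _ _ _ _ _ D0)
    -(graph_P2_den _ _ _ _ _ D0) /graph_P1 /graph_P2 zE.
rewrite S_webP; split.
  rewrite Pd_cubic2 -/(graph_den c v.1) => -[P0 d1 d2 D0].
  have [E1 E2] := PE P0 D0.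
  by split; [exact: P0|exact: D0|exact: aux2 E2 d2 D0|exact: aux2 E1 d1 D0].
move=> [P0 D0 n1 n2]; have [E1 E2] := PE P0 D0.
split; [exact: P0|exact: aux1 E1 n2|exact: aux1 E2 n1|].
by rewrite Pd_cubic2; exact: D0.
Qed.

Lemma parallelizable_flat v : S_web P v -> web_parallelizable_at P v.
Proof.
move=> /S_web_flat [P0 D0 n1 n2].
have [U [f [oU U0 f0 df [fI oF]]]] := riccati (b := m) p0 n1.
have [U' [g [oU' U'0 g0 dg [gI oG]]]] := riccati (b := m) q0 n2.
pose fg (w : C2 R) : C2 R := (f w.1, g w.2).
pose W : set (C2 R) := [set w | [/\ U w.1, U' w.2 & graph_den c (fg w) != 0]].
pose psi (w : C2 R) : C3 R := ((f w.1, g w.2), graph_z 0 0 p q c m (fg w)).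
have hf w : W w -> hasd (fun w : C2 R => f w.1) w (fun h => q1 (f w.1) * wx h).
  move=> [u _ _]; have [dfst fstE] := diff_fst w.
  have := hasd_comp dfst (df _ u).1; rewrite fstE; exact.
have hg w : W w -> hasd (fun w : C2 R => g w.2) w (fun h => q2 (g w.2) * wy h).
  move=> [_ u _]; have [dsnd sndE] := diff_snd w.
  have := hasd_comp dsnd (dg _ u).1; rewrite sndE; exact.
(* f_x = q2 / D^2 and f_y = q1 / D^2, so in the flow times (u, v) both partial derivatives of z
   equal q1 q2 / D^2. *)
have hz w : W w -> hasd (fun w : C2 R => graph_z 0 0 p q c m (fg w)) w
    (fun h => q1 (f w.1) * q2 (g w.2) / graph_den c (fg w) ^+ 2 * (wx h + wy h)).
  move=> ww; have h1 := hf w ww; have h2 := hg w ww; case: ww => _ _ D1.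
  rewrite /graph_den /fg /= in D1.
  rewrite /graph_z /graph_num /graph_den /fg /=; hasd_auto => //.
  by field.
have dpsi w (ww : W w) := hasd_pair3 (hf w ww) (hg w ww) (hz w ww).
have Wweb w : W w -> S_web P (psi w).
  move=> [u u' D1]; apply/S_web_flat; split=> //.
  - exact: (@cubic_graph _ 0 0 p q c m (fg w)).
  - exact: (df _ u).2.
  - exact: (dg _ u').2.
exists W, psi, (0, 0).
have W0 : W (0, 0).
  split=> //; rewrite /fg /= f0 g0.
  by case: (v) D0 => -[].
split=> //.
- split.
  + rewrite openE => w ww; have h1 := hf w ww; have h2 := hg w ww.
    have hD : exists L, hasd (fun w : C2 R => graph_den c (fg w)) w L.
      by eexists; rewrite /graph_den /fg /=; hasd_rules.
    case: hD => L hD; case: ww => u u' D1.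
    have n1' : \forall z \near w, U z.1.
      have nU : nbhs w.1 U by exact: open_nbhs_nbhs.
      have cf : continuous (fst : C2 R -> C^o) by move=> z; exact: cvg_fst.
      exact: (cf w U nU).
    have n2' : \forall z \near w, U' z.2.
      have nU : nbhs w.2 U' by exact: open_nbhs_nbhs.
      have cf : continuous (snd : C2 R -> C^o) by move=> z; exact: cvg_snd.
      exact: (cf w U' nU).
    have n3' : \forall z \near w, graph_den c (fg z) != 0.
      have cD : {for w, continuous (fun w : C2 R => graph_den c (fg w) : C^o)}.
        by apply: differentiable_continuous; case: hD.
      apply: (cD [set z : C^o | z != 0]); apply: open_nbhs_nbhs; split=> //.
      exact: (hasd_open_neq0 (@hasd_id C)).
    by near=> z; split; near: z.
  + by move=> w ww; have [] := dpsi w ww.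
  + move=> [u v1] [u' v1']; rewrite !inE => -[/= a1 a2 _] [/= b1 b2 _] [E1 E2 _].
    congr (_, _); first by apply: fI; rewrite ?mem_set.
    by apply: gI; rewrite ?mem_set.
  + move=> w ww [h1 h2]; rewrite (dpsi w ww).2 => -[/= E1 E2 _].
    case: ww => u u' _; have q1n := (df _ u).2; have q2n := (dg _ u').2.
    move/eqP: E1; rewrite mulf_eq0 (negbTE q1n) => /eqP ->.
    by move/eqP: E2; rewrite mulf_eq0 (negbTE q2n) => /eqP ->.
  (* Over the product of the images of the two flows, the web domain is the graph of z. *)
  exists [set z : C3 R | (f @` U) z.1.1 /\ (g @` U') z.1.2]; split.
    apply: openI.
      apply: (@open_comp _ _ (fun z : C3 R => z.1.1) (f @` U)) => // z _.
      by apply: differentiable_continuous; case: (hasd_x3 z).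
    apply: (@open_comp _ _ (fun z : C3 R => z.1.2) (g @` U')) => // z _.
    by apply: differentiable_continuous; case: (hasd_y3 z).
  apply/seteqP; split => [_ [w ww <-]|z].
    split; last exact: Wweb.
    by case: ww => u u' _; split; [exists w.1|exists w.2].
  move=> [[[u uu fu] [u' uu' gu]] /S_web_flat [Pz Dz _ _]].
  have zE := cubic_graph_z Dz Pz.
  have fgE : fg (u, u') = z.1.
    by rewrite /fg /= fu gu; case: (z.1).
  exists (u, u'); first by split=> //; rewrite fgE.
  rewrite /psi fgE -zE /= fu gu.
  by case: (z) => -[].
- have zE := cubic_graph_z D0 P0.
  rewrite /psi /fg /= f0 g0.
  have -> : ((x1 v, x2 v) : C2 R) = v.1 by case: (v.1).
  by rewrite -zE; case: (v) => -[].
(* The three foliations are the kernels of du, dv and du + dv. *)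
- move=> k; case: (ord3P k) => ->.
  + exists 1, 0; split; first by left; rewrite oner_eq0.
    move=> w ww; rewrite (hasd_derive _ (hf w ww)) (hasd_derive _ (hf w ww)).
    by rewrite !e2E /=; ring.
  + exists 0, 1; split; first by right; rewrite oner_eq0.
    move=> w ww; rewrite (_ : (fun z => _) = (fun z : C2 R => g z.2)); last first.
      by apply/funext => z; rewrite coord3_1.
    rewrite (hasd_derive _ (hg w ww)) (hasd_derive _ (hg w ww)).
    by rewrite !e2E /=; ring.
  + exists 1, 1; split; first by left; rewrite oner_eq0.
    move=> w ww; rewrite (hasd_derive _ (hz w ww)) (hasd_derive _ (hz w ww)).
    by rewrite !e2E /=; ring.
Unshelve. all: by end_near. Qed.

End Parallel.

(** * Assembly over the nine families *)

Lemma hess_not_flat_cubic (R : realType) (A B p q c m : R[i]) :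
  [\/ q != 0, B * p != 0, B * c != 0 | B * m != 0] -> A != 0 \/ p != 0 ->
  exists i j : 'I_3, i != j /\ ~ hess_flat (cubic A B p q c m : C3 R -> (R[i])^o) i j.
Proof.
move=> h1 h2; exists ord0, ord_max; split=> //.
by have [w [ww wn]] := exists_nonflat h1 h2; exact: hess_not_flat ww wn.
Qed.

Ltac cubic_form := apply/funext => v; rewrite /painleve_poly !coord3E /cubic /=; ring.

Theorem theorem1p3 (R : realType) (f : painleve_family R) :
  admissible f ->
  let P : C3 R -> (R[i])^o := painleve_poly f in
  (* (1) the 3-web (F_1,F_2,F_3) is nowhere locally parallelizable,
         except in the cases PII^FN, PII, PI (where it is) *)
  (~~ exceptional f -> forall p, S_web P p -> ~ web_parallelizable_at P p) /\
  (exceptional f -> forall p, S_web P p -> web_parallelizable_at P p) /\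
  (* (2) for some pair {i,j}, the Hess connection of (S, Omega, F_i, F_j) is not flat *)
  (exists i j : 'I_3, i != j /\ ~ hess_flat P i j).
Proof.
have one : (1 : R[i]) != 0 by rewrite oner_eq0.
have Mone : (-1 : R[i]) != 0 by rewrite oppr_eq0.
have none : (1 : R[i]) * 1 != 0 by rewrite mulr1.
move=> adm P; rewrite /P {P}; case: f adm => [s1 s2 s3|s1 s2|a b|a| |s1 s2|s|a|] /= adm.
- have -> : painleve_poly (PV s1 s2 s3) = cubic 1 1 (- (s1 + s2 * s3))
      (- (s2 + s1 * s3)) (- s3) (s3 ^+ 2 + s1 * s2 * s3 + 1) by cubic_form.
  have s30 : - s3 != 0 by rewrite oppr_eq0.
  split; first by move=> _ v _; exact: not_parallelizable_c.
  split=> //; apply: hess_not_flat_cubic; last by left.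
  by constructor 3; rewrite mul1r.
- have -> : painleve_poly (PVdeg s1 s2) = cubic 1 1 s1 s2 0 1 by cubic_form.
  split.
    (* Both (1, 0) and (-1, 0) are zeros of f1 = x^2 - (y^2 + s2 y + 1); the values - (2 + s1) and
       s1 - 2 of f2 there are not both zero. *)
    move=> _ v _; have [e|n] := eqVneq (2 + s1) 0.
      apply: (@not_parallelizable_c0 _ _ _ _ _ _ _ v (-1) 0) => //; first by ring.
      have -> : 1 * 0 ^+ 2 - (1 * (-1) ^+ 2 + s1 * (-1) + 1) = (2 + s1) - 4 by ring.
      by rewrite e sub0r oppr_eq0 pnatr_eq0.
    apply: (@not_parallelizable_c0 _ _ _ _ _ _ _ v 1 0) => //; first by ring.
    have -> : 1 * 0 ^+ 2 - (1 * 1 ^+ 2 + s1 * 1 + 1) = - (2 + s1) by ring.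
    by rewrite oppr_eq0.
  split=> //; apply: hess_not_flat_cubic; last by left.
  by constructor 4.
- case: adm => a0 b0.
  have -> : painleve_poly (PIIID6 a b) = cubic 1 1 (1 + a * b) (a + b) 0 (a * b).
    by cubic_form.
  split.
    (* f1 = x^2 - (y + a)(y + b) and f2 = y^2 - (x + 1)(x + ab). The zero (0, -a) of f1 works unless
       a = b. *)
    move=> _ v _; have [e|n] := eqVneq a b; last first.
      apply: (@not_parallelizable_c0 _ _ _ _ _ _ _ v 0 (- a)) => //; first by ring.
      have -> : 1 * (- a) ^+ 2 - (1 * 0 ^+ 2 + (1 + a * b) * 0 + a * b)
        = a * (a - b) by ring.
      by rewrite mulf_neq0 // subr_eq0.
    (* For a = b the zeros (a, 0) and (-a, 0) of f1 give f2 the values - a (1 + a)^2 and a (1 -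
       a)^2. *)
    rewrite -{}e; have [e|n] := eqVneq (1 + a) 0.
      apply: (@not_parallelizable_c0 _ _ _ _ _ _ _ v (- a) 0) => //; first by ring.
      have -> : 1 * 0 ^+ 2 - (1 * (- a) ^+ 2 + (1 + a * a) * (- a) + a * a)
        = a * ((1 + a) - 2 * a) ^+ 2 by ring.
      by rewrite e sub0r mulf_neq0 // expf_neq0 // oppr_eq0 mulf_neq0 // pnatr_eq0.
    apply: (@not_parallelizable_c0 _ _ _ _ _ _ _ v a 0) => //; first by ring.
    have -> : 1 * 0 ^+ 2 - (1 * a ^+ 2 + (1 + a * a) * a + a * a)
      = - (a * (1 + a) ^+ 2) by ring.
    by rewrite oppr_eq0 mulf_neq0 // expf_neq0.
  split=> //; apply: hess_not_flat_cubic; last by left.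
  by constructor 4; rewrite mul1r mulf_neq0.
- have -> : painleve_poly (PIIID7 a) = cubic 1 1 a 1 0 0 by cubic_form.
  split.
    move=> _ v _.
    apply: (@not_parallelizable_c0 _ _ _ _ _ _ _ v 0 (-1)) => //; first by ring.
    by have -> : 1 * (-1) ^+ 2 - (1 * 0 ^+ 2 + a * 0 + 0) = 1 by ring.
  split=> //; apply: hess_not_flat_cubic; last by left.
  by constructor 1.
- have -> : painleve_poly (PIIID8 R) = cubic 1 (-1) (-1) 0 0 0 by cubic_form.
  split.
    (* Here f1 = x^2 + y^2 vanishes at x = 1 and y a square root of -1, where f2 = - y^2 - x^2 + x
       equals 1. *)
    move=> _ v _.
    apply: (@not_parallelizable_c0 _ _ _ _ _ _ _ v 1 (sqrtc (-1))) => //.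
      by rewrite sqr_sqrtc; ring.
    have -> : -1 * sqrtc (-1) ^+ 2 - (1 * 1 ^+ 2 + -1 * 1 + 0) = 1 :> R[i].
      by rewrite sqr_sqrtc; ring.
    by [].
  split=> //; apply: hess_not_flat_cubic; last by left.
  by constructor 2; rewrite mulrNN.
- have -> : painleve_poly (PIV s1 s2) = cubic 1 0 (- (s2 ^+ 2 + s1 * s2))
     (- s2 ^+ 2) (- s2 ^+ 2) (s2 ^+ 2 + s1 * s2 ^+ 3) by cubic_form.
  have s20 : - s2 ^+ 2 != 0 by rewrite oppr_eq0 expf_neq0.
  split; first by move=> _ v _; exact: not_parallelizable_c.
  split=> //; apply: hess_not_flat_cubic; last by left.
  by constructor 1.
- have -> : painleve_poly (PIIFN s) = cubic 0 0 1 (-1) 1 s by cubic_form.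
  split=> //; split; first by move=> _ v; exact: parallelizable_flat.
  by apply: hess_not_flat_cubic; [constructor 1|right].
- have a0 : - a != 0 by rewrite oppr_eq0.
  have -> : painleve_poly (PII a) = cubic 0 0 (-1) (- a) (-1) (a + 1).
    by cubic_form.
  split=> //; split; first by move=> _ v; exact: parallelizable_flat.
  by apply: hess_not_flat_cubic; [constructor 1|right].
- have -> : painleve_poly (PI R) = cubic 0 0 1 1 0 1 by cubic_form.
  split=> //; split; first by move=> _ v; exact: parallelizable_flat.
  by apply: hess_not_flat_cubic; [constructor 1|right].
Qed.
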